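(* Let $q=2^e$ with $e\ge 2$ even, let $\alpha\in(\mathbb F_q^* )^3$ be a (nonzero) cube in $\mathbb F_q^*$, and let $f_\alpha:\mathbb F_{q^2}\to\mathbb F_2$ be $f_\alpha(x)=\operatorname{Tr}_{q^2}\bigl(\alpha(\sigma^{-1}(x))^3\bigr)$. Then $$\{W_{f_\alpha}(\beta):\beta\in\mathbb F_{q^2}\setminus\mathbb F_q\}=\begin{cases}\{0\},& e=2,\\ \{-2q,0,2q\},& e\ge 4.\end{cases}$$ Moreover, for $e\ge 4$, as $\beta$ ranges over $\mathbb F_{q^2}\setminus\mathbb F_q$, the values $2q$ and $-2q$ of $W_{f_\alpha}(\beta)$ each occur with multiplicity $q(q-4)/8$, while the value $0$ occurs with multiplicity $3q^2/4$.
   Context: $\mathbb F_q$ is regarded as the subfield of order $q$ of $\mathbb F_{q^2}$. $\operatorname{Tr}_{q^2}:\mathbb F_{q^2}\to\mathbb F_2$ is the absolute trace. Put $d=(q^2+q+1)/3$, an integer since $q\equiv 1\pmod 3$. The map $\sigma(X)=X+X^d+X^{dq}$ is a permutation of $\mathbb F_{q^2}$ (a known theorem of Ding, Qu, Wang, Yuan and Yuan), and $\sigma^{-1}$ denotes its inverse permutation. For a Boolean function $f:\mathbb F_{q^2}\to\mathbb F_2$, the Walsh transform is $W_f(\beta)=\sum_{x\in\mathbb F_{q^2}}(-1)^{f(x)+\operatorname{Tr}_{q^2}(\beta x)}\in\mathbb Z$ for $\beta\in\mathbb F_{q^2}$. *)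

(* Defs.v *)
From HB Require Import structures.
From mathcomp Require Import all_boot all_order all_algebra all_field.
From mathcomp Require Import ring zify.

Set Implicit Arguments.
Unset Strict Implicit.
Unset Printing Implicit Defensive.

Import GRing.Theory.
Local Open Scope ring_scope.

(* The absolute trace is the sum of the conjugates x ^ (2 ^ i), an element of
   the prime subfield of F; [absTrace x] is the element of 'F_2 that maps to it
   (the default value of [odflt] is never used in characteristic 2, see
   [absTraceE]). *)
Definition conjSum (F : finFieldType) (x : F) : F :=
  \sum_(i < logn 2 #|F|) x ^+ (2 ^ i).

Definition absTrace (F : finFieldType) (x : F) : 'F_2 :=
  odflt 0 [pick b : 'F_2 | (b : nat)%:R == conjSum x].

Lemma absTraceE (F : finFieldType) (n : nat) (x : F) :
  #|F| = (2 ^ n)%N -> (absTrace x : nat)%:R = conjSum x.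
Proof.
move=> cF; have ch2 := card_finPcharP cF (isT : prime 2).
have sq_id : conjSum x ^+ 2 = conjSum x.
  rewrite -[LHS](pFrobenius_autE ch2) /conjSum raddf_sum /= cF pfactorK //.
  under eq_bigr => i _ do rewrite pFrobenius_autE -exprM -expnSr.
  case: n cF => [|n] cF; first by rewrite !big_ord0.
  by rewrite big_ord_recr big_ord_recl /= -cF expf_card addrC expr1.
rewrite /absTrace; case: pickP => [b /eqP //|noneP].
have /eqP : conjSum x * (conjSum x - 1) = 0 by rewrite mulrBr mulr1 -expr2 sq_id subrr.
rewrite mulf_eq0 subr_eq0 => /orP[] /eqP tx.
  by have := noneP 0; rewrite tx eqxx.
by have := noneP 1; rewrite tx eqxx.
Qed.

Definition walsh (F : finFieldType) (f : F -> 'F_2) (beta : F) : int :=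
  \sum_(x : F) (-1) ^+ ((f x + absTrace (beta * x))%R : 'F_2).

Definition sigma (F : finFieldType) (q : nat) (x : F) : F :=
  let d := ((q ^ 2 + q + 1) %/ 3)%N in x + x ^+ d + x ^+ (d * q).

(* [sigma q] is injective: with s = sigma q x, v = x + s, T = s + s ^ q and
   S = s * s ^ q one has v ^ 3 = x * x ^ q * (T + v), hence
   v * (T ^ 2 + S) = T * S in characteristic 2. *)
Section SigmaInj.

Variables (F : finFieldType) (q e : nat).
Hypotheses (e_even : ~~ odd e) (qE : q = (2 ^ e)%N) (cF : #|F| = (q ^ 2)%N).

Let d := ((q ^ 2 + q + 1) %/ 3)%N.

Let ch2 : 2 \in [pchar F].
Proof. by apply: (@card_finPcharP _ 2 (e * 2)); rewrite // cF qE -expnM. Qed.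

Let two0 : 2%:R = 0 :> F.
Proof. exact: pcharf0. Qed.

Let frobD (x y : F) : (x + y) ^+ q = x ^+ q + y ^+ q.
Proof.
apply: exprDn_pchar; rewrite qE.
by apply/(pnat_dvd (dvdnn _))/pnatP; rewrite ?expn_gt0 // => p pr_p;
   rewrite Euclid_dvdX // => /andP[]; rewrite dvdn_prime2 // => /eqP->.
Qed.

Let frobK (x : F) : (x ^+ q) ^+ q = x.
Proof. by rewrite -exprM mulnn -cF expf_card. Qed.

Let q_mod3 : exists m, q = (3 * m + 1)%N.
Proof.
have -> : q = (4 ^ e./2)%N.
  by rewrite qE -[in LHS](odd_double_half e) (negbTE e_even) add0n -mul2n expnM.
elim: e./2 => [|k [m IH]]; first by exists 0%N.
by exists (4 * m + 1)%N; rewrite expnS IH; lia.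
Qed.

Lemma sigma_key (x : F) (s := sigma q x) (v := x ^+ d + x ^+ (d * q)) :
  let T := s + s ^+ q in let S := s * s ^+ q in
  s = x + v /\ v * (T ^+ 2 + S) = T * S.
Proof.
have sE : s = x + v by rewrite /s /sigma -/d addrA.
split=> //.
have [m qm] := q_mod3.
have dE : d = (q * m + (2 * m + 1))%N.
  rewrite /d qm; have -> : ((3 * m + 1) ^ 2 + (3 * m + 1) + 1
    = ((3 * m + 1) * m + (2 * m + 1)) * 3)%N by ring.
  by rewrite mulnK.
pose y := x ^+ q; pose a := x ^+ d; pose b := x ^+ (d * q).
have bE : b = a ^+ q by rewrite /b exprM.
have vq : v ^+ q = v by rewrite /v -/a -/b frobD bE frobK addrC.
have a3 : a ^+ 3 = x * x * y.
  rewrite -exprM; have -> : (d * 3 = q ^ 2 + q + 1)%N by rewrite dE qm; ring.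
  by rewrite !exprD -cF expf_card expr1 -/y mulrAC.
have b3 : b ^+ 3 = y * y * x by rewrite bE exprAC a3 !exprMn frobK.
have ab : a * b = x * y.
  have Pq : (x * y) ^+ q = x * y by rewrite exprMn frobK mulrC.
  have -> : a * b = (x * y) ^+ d by rewrite exprMn /b mulnC exprM.
  rewrite dE exprD exprM Pq -exprD -[RHS]Pq qm; congr (_ ^+ _); lia.
have sqE : s ^+ q = y + v by rewrite sE frobD vq.
rewrite sqE sE; apply/eqP; rewrite -subr_eq0.
have v3 : v ^+ 3 = x * x * y + y * y * x + 2%:R * (x * y * v) + x * y * v.
  by rewrite -a3 -b3 -ab /v -/a -/b; ring.
rewrite two0 mul0r addr0 in v3.
have -> : v * ((x + v + (y + v)) ^+ 2 + (x + v) * (y + v))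
            - (x + v + (y + v)) * ((x + v) * (y + v))
  = 2%:R * (v ^+ 3 + v ^+ 2 * (x + y))
    + (v ^+ 3 - (x * x * y + y * y * x + x * y * v)) by ring.
by rewrite two0 mul0r v3 subrr addr0.
Qed.

Lemma sigma_inj : injective (@sigma F q).
Proof.
have sigma0 (z : F) : sigma q z = 0 -> z = 0.
  move=> s0; have [] := sigma_key z; rewrite s0.
  set v := _ + _ => /esym/eqP; rewrite addr_eq0 (oppr_pchar2 ch2) => /eqP zv _.
  have zq : z ^+ q = z.
    by rewrite {1}zv /v frobD exprM frobK addrC -exprM -/v -zv.
  by rewrite zv /v mulnC exprM zq -mulr2n -mulr_natl two0 mul0r.
move=> x x' sxx'; have [] := sigma_key x; have [] := sigma_key x'.
rewrite -sxx'; set s := sigma q x; set T := s + _; set S := s * _.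
set v' := x' ^+ d + _ => sx' k'; set v := x ^+ d + _ => sx k.
have [TS|TS] := eqVneq (T ^+ 2 + S) 0; last first.
  have vv : v = v' by apply: (mulIf TS); rewrite k k'.
  by move: sx; rewrite sx' vv => /addIr ->.
have TS0 : T * S = 0 by rewrite -k TS mulr0.
have S0 : S = 0.
  move/eqP: TS0; rewrite mulf_eq0 => /orP[] /eqP // T0.
  by rewrite T0 expr0n add0r in TS.
have s0 : s = 0.
  by move/eqP: S0; rewrite mulf_eq0 expf_eq0 => /orP[|/andP[_]] /eqP.
by rewrite (sigma0 x s0) (sigma0 x') // -sxx'.
Qed.

End SigmaInj.

Definition sigma_inv (F : finFieldType) (q e : nat) (e_even : ~~ odd e)
    (qE : q = (2 ^ e)%N) (cF : #|F| = (q ^ 2)%N) : F -> F :=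
  invF (sigma_inj e_even qE cF).

Definition falpha (F : finFieldType) (q e : nat) (e_even : ~~ odd e)
    (qE : q = (2 ^ e)%N) (cF : #|F| = (q ^ 2)%N) (alpha x : F) : 'F_2 :=
  absTrace (alpha * sigma_inv e_even qE cF x ^+ 3).

(* Main.v *)
Require Import Defs.
From HB Require Import structures.
From mathcomp Require Import all_boot all_order all_algebra all_field.
From mathcomp Require Import all_fingroup all_solvable ring zify.
Import GRing.Theory.
Local Open Scope ring_scope.

(** Write [xb] for [x ^ q] and [chi] for the additive character of F with values
    1 and -1.  Replacing the summation variable [x] by [sigma q x] and scaling
    by [c], where [alpha = c ^ 3], turns the Walsh transform at [beta] into
      [walshV b = \sum_x chi (x ^ 3 + b * sigma q x)]  with [b = beta / c].

    The exponents of [sigma] become simple on cubes: for [g] in the subfield,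
    [sigma q (g * z ^ 3) = g * (z ^ 3 + z ^ 2 * zb + z * zb ^ 2)].  Let [g]
    range over three representatives, in the subfield, of the cosets of the
    nonzero cubes.  Then [3 * walshV b] is the sum over [g] and [z] of the terms
    with [x = g * z ^ 3], and the trace of the argument of [chi] is a quadratic
    form in [z].  With a primitive cube root of unity [w] and [z = y + w * yb]
    this form is the trace of [g ^ 3 * y ^ 8 * yb + g * l * y ^ 2 * yb], where
    [l = w * b + w ^ 2 * bb] ([quadsumE]).  These are the three sums met with
    the Kasami exponent [4 ^ k - 2 ^ k + 1], for [k = e + 1], at the frequency
    [l]; this exponent is [5 - 2 * q] modulo [q ^ 2 - 1].

    Each sum is 1 modulo 3, because it comes from a sum over cubes, and its
    square is [q ^ 2] times the size of the radical of the form.  The radical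
    is a vector space over the field of order 4 with at most 64 elements, so the
    sum is [(-2) ^ j * q], where [4 ^ j] is the size of the radical and [j <= 3]
    ([quadsum_val]).

    It remains to see which triples of exponents [j] occur.  The radical for [g]
    is the set of zeros of [h + a * g * h ^ 4 + ab ^ 2 * g ^ 5 * h ^ 16 +
    g ^ 21 * h ^ 64], with [a = lb ^ 4].  Rewriting this as a first-order
    semilinear system with 3 x 3 companion matrix [C], the radical is nonzero
    exactly when [g ^ ((q ^ 2 - 1) / 3)], a cube root of unity, is an eigenvalue
    of the product [B] of the [e] successive twists of [C] by the fourth power
    map; one direction is Hilbert's Theorem 90 ([eigenvalue_radical]).  Two
    facts about [B] decide the matter.  It has determinant 1, so the values of
    its characteristic polynomial at the three cube roots of unity add up to 0.
    It preserves a form that is sesquilinear for [x |-> x ^ (2 * q)]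
    ([normC_gram]), a generator of the Galois group of F, so these three values
    are fixed by it and lie in the prime field.  Hence one or all three of the
    cube roots are eigenvalues ([norm_eigenvalues]).  In the first case
    [walshV b = q * (1 + 1 + (-2) ^ j) / 3] with [1 <= j <= 3]; in the second
    all three eigenspaces are lines, every [j] is 1, and [walshV b = -2 * q].
    So [walshV] only takes the values 0, [2 * q] and [-2 * q].

    The multiplicities follow from the first two moments of [walshV] outside
    the subfield, which are 0 and [q ^ 4 - 4 * q ^ 3]: both are differences of a
    sum over F, given by orthogonality and the injectivity of [sigma], and a sum
    over the subfield, where [walshV] is the Walsh transform of the trace of
    [x ^ 3]. *)

(** * Frobenius powers and the additive character *)

(** The power [x ^ (2 ^ k)] as a ring morphism; the proof that F has
    characteristic 2 is an argument so that the morphism structure can be found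
    by unification. *)
Definition frob (F : finFieldType) (k : nat) of 2 \in [pchar F] : F -> F :=
  fun x => x ^+ (2 ^ k).

Section Frobenius.

Variables (F : finFieldType) (k : nat) (ch2 : 2 \in [pchar F]).

Fact frob_is_zmod_morphism : zmod_morphism (frob F k ch2).
Proof.
move=> x y; rewrite /frob !(oppr_pchar2 ch2); apply: exprDn_pchar.
by rewrite pnatX pnatE // ch2.
Qed.

Fact frob_is_monoid_morphism : monoid_morphism (frob F k ch2).
Proof. by split=> [|x y]; rewrite /frob ?expr1n ?exprMn. Qed.

HB.instance Definition _ :=
  GRing.isZmodMorphism.Build F F (frob F k ch2) frob_is_zmod_morphism.
HB.instance Definition _ :=
  GRing.isMonoidMorphism.Build F F (frob F k ch2) frob_is_monoid_morphism.

End Frobenius.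

Section QuadraticExtension.

Variables (F : finFieldType) (q e : nat).
Hypotheses (e_ge2 : (2 <= e)%N) (e_even : ~~ odd e).
Hypotheses (qE : q = (2 ^ e)%N) (cF : #|F| = (q ^ 2)%N).

Implicit Types (x y z b g h : F).

Let ch2 : 2 \in [pchar F].
Proof. by apply: (@card_finPcharP _ 2 (e * 2)); rewrite // cF qE -expnM. Qed.

Let two0 : 2%:R = 0 :> F.
Proof. exact: pcharf0. Qed.

Let addff x : x + x = 0.
Proof. exact: addrr_pchar2. Qed.

Lemma frobD k x y : (x + y) ^+ (2 ^ k) = x ^+ (2 ^ k) + y ^+ (2 ^ k).
Proof.
by apply: exprDn_pchar; rewrite pnatX pnatE // ch2.
Qed.

Lemma conjD x y : (x + y) ^+ q = x ^+ q + y ^+ q.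
Proof. by rewrite qE frobD. Qed.

Lemma conjM x y : (x * y) ^+ q = x ^+ q * y ^+ q.
Proof. exact: exprMn. Qed.

Lemma conjX x n : (x ^+ n) ^+ q = (x ^+ q) ^+ n.
Proof. exact: exprAC. Qed.

Lemma conjK x : (x ^+ q) ^+ q = x.
Proof. by rewrite -exprM mulnn -cF expf_card. Qed.

Lemma frob_inj k : injective (fun x : F => x ^+ (2 ^ k)).
Proof.
move=> x y /eqP; rewrite -subr_eq0 -(oppr_pchar2 ch2 (y ^+ _)) opprK -frobD.
by rewrite expf_eq0 expn_gt0 /= addr_eq0 (oppr_pchar2 ch2) => /eqP.
Qed.

Lemma frob_sum k (I : Type) (r : seq I) (P : pred I) (G : I -> F) :
  (\sum_(i <- r | P i) G i) ^+ (2 ^ k) = \sum_(i <- r | P i) G i ^+ (2 ^ k).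
Proof.
apply: (big_morph (fun x => x ^+ (2 ^ k)) (frobD k)).
by rewrite expr0n expn_eq0.
Qed.

(** The additive character of F given by the absolute trace, with integer
    values 1 and -1. *)
Definition chi x : int := (-1) ^+ (absTrace x).

Lemma conjSumD x y : conjSum (x + y) = conjSum x + conjSum y.
Proof. by rewrite /conjSum -big_split; apply: eq_bigr => i _; apply: frobD. Qed.

Lemma chiE x :
  (conjSum x == 0) && (chi x == 1) || (conjSum x == 1) && (chi x == -1).
Proof.
have := @absTraceE F (e * 2) x; rewrite cF qE -expnM => /(_ erefl) <-.
rewrite /chi; case: (absTrace x) => [[|[|k]]] //= ltk.
- by rewrite expr0 !eqxx.
- by rewrite expr1 !eqxx orbT.
Qed.

Lemma chi_sgn x : chi x = 1 \/ chi x = -1.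
Proof. by case/orP: (chiE x) => /andP[_ /eqP]; [left | right]. Qed.

Lemma chiD x y : chi (x + y) = chi x * chi y.
Proof.
have := chiE (x + y); rewrite conjSumD.
case/orP: (chiE x) => /andP[/eqP-> /eqP->];
  case/orP: (chiE y) => /andP[/eqP-> /eqP->];
  rewrite ?addr0 ?add0r ?addff ?eqxx ?oner_eq0 ?(eq_sym 0) ?oner_eq0 ?orbF ?orFb
          //= => /eqP->; by [].
Qed.

Lemma chi_frob k x : chi (x ^+ (2 ^ k)) = chi x.
Proof.
elim: k => [|k IH]; first by rewrite expr1.
rewrite -{}IH expnSr exprM; move: (x ^+ _) => {}x.
have sq : conjSum (x ^+ 2) = conjSum x ^+ 2.
  rewrite /conjSum -[RHS]/((\sum_(i < _) x ^+ (2 ^ i)) ^+ (2 ^ 1)) frob_sum.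
  by apply: eq_bigr => i _; rewrite -!exprM mulnC.
have := chiE (x ^+ 2); rewrite sq.
case/orP: (chiE x) => /andP[/eqP-> /eqP->];
  by rewrite ?expr0n ?expr1n ?eqxx ?oner_eq0 ?(eq_sym 0) ?oner_eq0 ?orbF ?orFb
          //= => /eqP->.
Qed.

Lemma chi_conj x : chi (x ^+ q) = chi x.
Proof. by rewrite qE chi_frob. Qed.

Lemma chi0 : chi 0 = 1.
Proof. by have := chiD 0 0; rewrite addr0; case: (chi_sgn 0) => ->. Qed.

Lemma chi_sq x : chi x * chi x = 1.
Proof. by rewrite -chiD addff chi0. Qed.

Lemma chi_tr x : chi (x + x ^+ q) = 1.
Proof. by rewrite chiD chi_conj chi_sq. Qed.

(** Independence of the first powers of a Frobenius map: a linearized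
    polynomial of degree less than the order of F, with a nonzero linear
    coefficient, is not identically zero on F. *)
Lemma linearized_nonzero (r n : nat) (w : nat -> F) :
    (1 < r)%N -> (r ^ n < #|F|)%N -> w 0%N != 0 ->
  exists c, \sum_(i < n.+1) w i * c ^+ (r ^ i) != 0.
Proof.
move=> r1 ltF w0; pose p : {poly F} := \sum_(i < n.+1) w i *: 'X^(r ^ i).
case: (pickP [pred c | \sum_(i < n.+1) w i * c ^+ (r ^ i) != 0]) => [c ?|no].
  by exists c.
have sp : (size p <= (r ^ n).+1)%N.
  apply: (leq_trans (size_sum _ _ _)); apply/bigmax_leqP => i _.
  apply: (leq_trans (size_scale_leq _ _)).
  by rewrite size_polyXn ltnS leq_exp2l // -ltnS.
have p1 : p`_1 = w 0%N.
  rewrite /p coef_sum big_ord_recl coefZ coefXn eqxx mulr1 big1 ?addr0 //.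
  move=> i _; rewrite coefZ coefXn /= /bump expnD expn1.
  by case: eqP => [|_]; rewrite ?mulr0 //; nia.
have p0 : p != 0 by apply: contra w0 => /eqP p0; rewrite -p1 p0 coef0.
have := max_poly_roots p0 (_ : all (root p) (enum F)) (enum_uniq F).
rewrite -cardE => H; suff : (#|F| < (r ^ n).+1)%N by rewrite ltnS leqNgt ltF.
apply: leq_trans sp; apply: H; apply/allP => c _; rewrite rootE.
rewrite /p horner_sum; under eq_bigr do rewrite hornerZ hornerXn.
by have /negbFE := no c.
Qed.

Lemma chi_nontriv : exists x, chi x = -1.
Proof.
have [|||x] := @linearized_nonzero 2 (e * 2).-1 (fun=> 1); rewrite ?oner_eq0 //.
  by rewrite cF qE -expnM ltn_exp2l //; lia.
rewrite prednK; last by lia.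
under eq_bigr do rewrite mul1r.
rewrite [X in X != 0](_ : _ = conjSum x); last first.
  by rewrite /conjSum cF qE -expnM pfactorK.
move=> /negbTE nz; exists x; have := chiE x.
by rewrite nz => /andP[_ /eqP].
Qed.

(** A nontrivial additive character sums to 0 over an additive subgroup. *)
Lemma sum_chi_subgroup (A : {pred F}) (c : F) :
    (forall x y, x \in A -> y \in A -> x + y \in A) ->
    (exists2 x, x \in A & chi (c * x) = -1) ->
  \sum_(x in A) chi (c * x) = 0.
Proof.
move=> AD [x0 Ax0 cx0].
have AD' x : (x + x0 \in A) = (x \in A).
  apply/idP/idP => [H|H]; last exact: AD.
  by rewrite -[x]addr0 -(addff x0) addrA AD.
have : \sum_(x in A) chi (c * x) = - \sum_(x in A) chi (c * x).
  rewrite {1}(reindex_inj (addIr x0)) /= -sumrN.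
  by apply: eq_big => [x|x _]; rewrite ?AD' // mulrDr chiD cx0 mulrN1.
by move: (\sum_(x in A) _) => s; lia.
Qed.

Lemma sum_chi c : \sum_x chi (c * x) = if c == 0 then (q ^ 2)%:Z else 0.
Proof.
case: eqVneq => [->|c0].
  under eq_bigr do rewrite mul0r chi0.
  by rewrite sumr_const cF natz.
have [x0 x0E] := chi_nontriv.
have := @sum_chi_subgroup predT c; apply=> //.
by exists (x0 / c); rewrite // mulrC divfK.
Qed.

(** * Cosets of the cubes *)

Let q_mod3 : exists m, q = (3 * m + 1)%N.
Proof.
have -> : q = (4 ^ e./2)%N.
  by rewrite qE -[in LHS](odd_double_half e) (negbTE e_even) add0n -mul2n expnM.
elim: e./2 => [|k [m IH]]; first by exists 0%N.
by exists (4 * m + 1)%N; rewrite expnS IH; lia.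
Qed.

(* The nonzero cubes are the elements with [x ^ M = 1]. *)
Let M := ((q ^ 2).-1 %/ 3)%N.

Let q_ge4 : (4 <= q)%N.
Proof. by rewrite qE -[4%N]/(2 ^ 2)%N leq_exp2l. Qed.

Let M3 : (M * 3 = (q ^ 2).-1)%N.
Proof.
rewrite /M divnK //; have [m ->] := q_mod3.
by apply/dvdnP; exists (3 * m ^ 2 + 2 * m)%N; lia.
Qed.

Let M_gt0 : (0 < M)%N.
Proof. by have := M3; nia. Qed.

Let expM3 x : x != 0 -> x ^+ (M * 3) = 1.
Proof.
move=> x0; apply: (mulfI x0); rewrite mulr1 -exprS M3 prednK;
  last by have := q_ge4; nia.
by rewrite -cF expf_card.
Qed.

Let prim_root_ex : exists z : F, ((q ^ 2).-1).-primitive_root z.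
Proof.
pose rs := [seq x <- enum F | x != 0].
suff /hasP[z _ zP] : has ((q ^ 2).-1).-primitive_root rs by exists z.
apply: has_prim_root.
- by rewrite -M3; lia.
- apply/allP => x; rewrite mem_filter => /andP[x0 _].
  by rewrite unity_rootE -M3 expM3.
- by rewrite filter_uniq // enum_uniq.
- rewrite -cF size_filter (_ : count _ _ = #|predC1 (0 : F)|).
    by rewrite cardC1.
  by rewrite cardE /enum_mem size_filter count_filter -enumT;
    apply: eq_count => x; rewrite /= andbT.
Qed.

Lemma is_cube u : u ^+ M = 1 -> exists z, u = z ^+ 3.
Proof.
move=> uM; have [z zP] := prim_root_ex.
have uN : u ^+ (q ^ 2).-1 = 1 by rewrite -M3 exprM uM expr1n.
have [[i /= _] ui] := prim_rootP zP uN.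
have : ((q ^ 2).-1 %| i * M)%N by rewrite (prim_order_dvd zP) exprM -ui uM.
rewrite -M3 [(M * 3)%N]mulnC dvdn_pmul2r // => /dvdnP[k ik].
by exists (z ^+ k); rewrite ui ik exprM.
Qed.

(** Some element of the subfield of order q is not a cube. *)
Lemma noncube_ex :
  exists g, [/\ g != 0, g ^+ q = g & (g ^+ M) ^+ 2 + g ^+ M + 1 = 0].
Proof.
have [z zP] := prim_root_ex; have N0 : (0 < (q ^ 2).-1)%N by rewrite -M3; lia.
have z0 : z != 0.
  by have := prim_expr_order zP; apply: contra_eq_neq => ->;
    rewrite expr0n gtn_eqF // eq_sym oner_eq0.
(* The norm to the subfield of a generator: 3 does not divide [q + 1]. *)
exists (z ^+ q.+1); split; first by rewrite expf_neq0.
  by rewrite exprAC [in LHS]exprS conjK -exprSr.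
set w := _ ^+ M.
have w3 : w ^+ 3 = 1 by rewrite /w -exprM expM3 // expf_neq0.
have w1 : w - 1 != 0.
  rewrite subr_eq0 /w -exprM -(prim_order_dvd zP) -M3 [(M * 3)%N]mulnC
    dvdn_pmul2r //.
  by have [m ->] := q_mod3; lia.
apply: (mulfI w1); rewrite mulr0 -[RHS](subrr (w ^+ 3)) {2}w3; ring.
Qed.

(** * The map sigma on cubes *)

(** The Walsh transform at [b] of the function taking [sigma q x] to
    the trace of [x ^ 3]. *)
Definition walshV b : int := \sum_x chi (x ^+ 3 + b * sigma q x).

(* The exponent of [sigma], with [q = 3 * m + 1]. *)
Let dE : exists2 m, q = (3 * m + 1)%N &
  ((q ^ 2 + q + 1) %/ 3 = q * m + (2 * m + 1))%N.
Proof.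
have [m qm] := q_mod3; exists m => //.
rewrite qm; have -> : ((3 * m + 1) ^ 2 + (3 * m + 1) + 1
  = ((3 * m + 1) * m + (2 * m + 1)) * 3)%N by ring.
by rewrite mulnK.
Qed.

Lemma sigma_scale g x : g ^+ q = g -> sigma q (g * x) = g * sigma q x.
Proof.
move=> gq; have [m qm d_m] := dE.
have gd : g ^+ ((q ^ 2 + q + 1) %/ 3) = g.
  by rewrite d_m exprD exprM gq -exprD -[RHS]gq qm; congr (_ ^+ _); lia.
by rewrite /sigma exprM exprMn gd exprMn gq -exprM !mulrDr.
Qed.

Lemma sigma_cube z : sigma q (z ^+ 3) =
  z ^+ 3 + z ^+ 2 * z ^+ q + z * (z ^+ q) ^+ 2.
Proof.
have [m qm d_m] := dE.
have zd : (z ^+ 3) ^+ ((q ^ 2 + q + 1) %/ 3) = z ^+ 2 * z ^+ q.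
  rewrite -exprM; have -> : (3 * ((q ^ 2 + q + 1) %/ 3) = q ^ 2 + q + 1)%N.
    by rewrite d_m qm; ring.
  by rewrite !exprD -cF expf_card; ring.
by rewrite /sigma exprM zd conjM conjX conjK; ring.
Qed.

Lemma sigma0 : sigma q (0 : F) = 0.
Proof.
rewrite -[X in sigma q X](mul0r 0) sigma_scale ?mul0r //.
by rewrite expr0n gtn_eqF //; lia.
Qed.

(** * Summation over the cosets of the cubes *)

Section Noncube.

(* The elements 1, [g0] and [g0 ^ 2] of the subfield represent the three cosets
   of the nonzero cubes, on which [x ^ M] is 1, [w] and [w ^ 2]. *)
Variables g0 w : F.
Hypotheses (g0_neq0 : g0 != 0) (g0_conj : g0 ^+ q = g0).
Hypotheses (wE : w = g0 ^+ M) (g0_noncube : w ^+ 2 + w + 1 = 0).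

Let w2 : w ^+ 2 = w + 1.
Proof.
rewrite -[RHS]addr0 -g0_noncube.
have -> : w + 1 + (w ^+ 2 + w + 1) = w ^+ 2 + (w + w + (1 + 1)) by ring.
by rewrite !addff !addr0.
Qed.

Let w3 : w ^+ 3 = 1.
Proof. by rewrite wE -exprM expM3. Qed.

Let w_neq0 : w != 0.
Proof. by rewrite wE expf_neq0. Qed.

Let w_neq1 : w != 1.
Proof.
apply/eqP => w1; have := w2; rewrite w1 expr1n addff => /eqP.
by rewrite oner_eq0.
Qed.

Let w_conj : w ^+ q = w.
Proof. by rewrite wE exprAC g0_conj. Qed.

Lemma card_cube_roots z : z != 0 -> #|[pred x | x ^+ 3 == z ^+ 3]| = 3.
Proof.
move=> z0.
rewrite (@eq_card _ _ (mem [:: z; w * z; w ^+ 2 * z])) => [|x].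
  have neq a b : a - b != 0 -> a * z != b * z.
    by rewrite subr_eq0 (inj_eq (mulIf z0)).
  apply/card_uniqP; rewrite /= !inE !negb_or andbT -{1 3}[z]mul1r w2.
  by rewrite !neq // ?subr_eq0 1?eq_sym // -subr_eq0 ?addrK //
             addrAC subrr add0r oner_eq0.
rewrite !inE -[in LHS]subr_eq0.
have -> : x ^+ 3 - z ^+ 3 = (x - z) * (x - w * z) * (x - w ^+ 2 * z).
  have -> : (x - z) * (x - w * z) * (x - w ^+ 2 * z) =
    x ^+ 3 - x ^+ 2 * z * (w ^+ 2 + w + 1)
    + x * z ^+ 2 * (w * (w ^+ 2 + w + 1)) - w ^+ 3 * z ^+ 3 by ring.
  by rewrite g0_noncube w3 mul1r !mulr0 subr0 addr0.
by rewrite !mulf_eq0 !subr_eq0 orbA.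
Qed.

(** Cubing is three-to-one on nonzero elements. *)
Lemma sum_cube_coset (G : F -> int) g : g != 0 ->
  \sum_z G (g * z ^+ 3) = G 0 + 3 * \sum_(x | x ^+ M == g ^+ M) G x.
Proof.
move=> gn0; rewrite (bigD1 0) //= expr0n mulr0; congr (_ + _).
rewrite (partition_big (fun z => g * z ^+ 3) (fun x => x ^+ M == g ^+ M)) /=;
  last first.
  by move=> z z0; rewrite exprMn -exprM mulnC expM3 // mulr1.
rewrite mulr_sumr; apply: eq_bigr => x /eqP xM.
have gM : g ^+ M != 0 by rewrite expf_neq0.
have [|z0 xz0] := @is_cube (x / g); first by rewrite exprMn exprVn xM mulfV.
have xE : x = g * z0 ^+ 3 by rewrite -xz0 mulrC divfK.
have z0n : z0 != 0.
  by apply: contraNneq gM => z00;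
    rewrite -xM xE z00 expr0n mulr0 expr0n gtn_eqF.
rewrite (eq_bigr (fun=> G x)) => [|z /andP[_ /eqP->] //].
rewrite sumr_const (@eq_card _ _ [pred x | x ^+ 3 == z0 ^+ 3]) => [|z].
  by rewrite card_cube_roots // mulr_natl.
rewrite !inE /= unfold_in /= xE (inj_eq (mulfI gn0)).
case: (eqVneq (z ^+ 3)) => [zz|_] /=; last by rewrite andbF.
rewrite andbT; apply: contraNneq z0n => z00.
by move/esym/eqP: zz; rewrite z00 expr0n expf_eq0.
Qed.

(** * Reduction to quadratic forms *)

Lemma sum_noncube_cosets (G : F -> int) :
  3 * \sum_x G x = \sum_(i < 3) \sum_z G (g0 ^+ i * z ^+ 3).
Proof.
rewrite (eq_bigr (fun i : 'I_3 =>
  G 0 + 3 * \sum_(x | x ^+ M == (g0 ^+ i) ^+ M) G x)); last first.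
  by move=> i _; apply: sum_cube_coset; rewrite expf_neq0.
rewrite big_split /= sumr_const card_ord -mulr_sumr.
suff -> : \sum_x G x =
  G 0 + \sum_(i < 3) \sum_(x | x ^+ M == (g0 ^+ i) ^+ M) G x.
  by rewrite mulrDr mulr_natl.
rewrite (bigD1 0) //=; congr (_ + _).
rewrite !big_ord_recl big_ord0 addr0 /= /bump /=.
rewrite !(big_mkcond (fun x => _ == _)) !(big_mkcond (fun x => _ != _)).
rewrite -!big_split.
apply: eq_bigr => x _ /=.
rewrite expr0 expr1n expr1 (exprAC g0) -wE.
case: eqVneq => [->|x0] /=.
  rewrite expr0n gtn_eqF //= eq_sym oner_eq0 !(eq_sym 0).
  by rewrite (negbTE w_neq0) expf_eq0 (negbTE w_neq0).
have : (x ^+ M - 1) * (x ^+ M - w) * (x ^+ M - w ^+ 2) = 0.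
  have xM3 : x ^+ M ^+ 3 = 1 by rewrite -exprM expM3.
  have -> : (x ^+ M - 1) * (x ^+ M - w) * (x ^+ M - w ^+ 2) =
    (x ^+ M ^+ 3 - w ^+ 3)
    + (w ^+ 2 + w + 1) * (x ^+ M * w - x ^+ M ^+ 2) by ring.
  by rewrite xM3 w3 g0_noncube mul0r subrr addr0.
have w21 : w ^+ 2 != 1.
  by rewrite w2 -subr_eq0 addrK.
have w2w : w ^+ 2 != w.
  by rewrite w2 -subr_eq0 addrAC subrr add0r oner_eq0.
move/eqP; rewrite !mulf_eq0 !subr_eq0 => /orP[/orP[]|] /eqP->.
- by rewrite eqxx eq_sym (negbTE w_neq1) eq_sym (negbTE w21) !addr0.
- by rewrite eqxx (negbTE w_neq1) eq_sym (negbTE w2w) add0r addr0.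
- by rewrite eqxx (negbTE w21) (negbTE w2w) !add0r.
Qed.

(** The quadratic form attached to [g] and [l] is the absolute trace of
    [form g l y]. *)
Definition form g l y : F :=
  g ^+ 3 * (y ^+ 8 * y ^+ q) + g * l * (y ^+ 2 * y ^+ q).

(** The quadratic Gauss sum of the form. *)
Definition quadsum g l : int := \sum_y chi (form g l y).

Lemma twist_inj : injective (fun y => y + w * y ^+ q).
Proof.
apply: (@can_inj _ _ _ (fun z => z ^+ q + w ^+ 2 * z)) => y.
rewrite conjD exprMn w_conj conjK.
have -> : y ^+ q + w * y + w ^+ 2 * (y + w * y ^+ q) =
          y ^+ q * (1 + w ^+ 3) + w * y + w ^+ 2 * y by ring.
by rewrite w3 addff mulr0 add0r w2 mulrDl mul1r addrA addff add0r.
Qed.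

(** In the coordinate [y] with [z = y + w * y ^ q], the term [z ^ 9] and the map
    [sigma] contribute one monomial each, up to elements of trace 0. *)
Lemma quadsumE g b : g ^+ q = g ->
  \sum_z chi ((g * z ^+ 3) ^+ 3 + b * sigma q (g * z ^+ 3)) =
  quadsum g (w * b + w ^+ 2 * b ^+ q).
Proof.
move=> gq; rewrite (reindex_inj twist_inj); apply: eq_bigr => y _ /=.
rewrite sigma_scale // sigma_cube; set z := y + _.
have zq : z ^+ q = y ^+ q + w * y by rewrite conjD exprMn w_conj conjK.
rewrite {}zq {}/z /form.
have [s yq sq] : exists2 s, y ^+ q = s & s ^+ q = y.
  by exists (y ^+ q); rewrite ?conjK.
rewrite yq.
have -> : (y + w * s) ^+ 3 + (y + w * s) ^+ 2 * (s + w * y)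
    + (y + w * s) * (s + w * y) ^+ 2 = w * y ^+ 2 * s + w ^+ 2 * y * s ^+ 2.
  have -> : (y + w * s) ^+ 3 + (y + w * s) ^+ 2 * (s + w * y)
    + (y + w * s) * (s + w * y) ^+ 2 =
    w * y ^+ 2 * s + w ^+ 2 * y * s ^+ 2
    + (w ^+ 2 + w + 1) * (y ^+ 3 + w * s ^+ 3)
    + (w ^+ 3 - 1) * (y ^+ 2 * s + y * s ^+ 2)
    + 2%:R * ((2 * w + w ^+ 2 + 1) * y ^+ 2 * s
              + (2 * w ^+ 2 + w + 1) * y * s ^+ 2) by ring.
  by rewrite g0_noncube two0 w3 subrr !mul0r !addr0.
have -> : (g * (y + w * s) ^+ 3) ^+ 3 =
  g ^+ 3 * ((y + w * s) ^+ 8 * (y + w * s)).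
  by ring.
(* The term [z ^ 9 = z ^ 8 * z]: two of its four monomials are conjugate, and so
   are the two others up to the factor [w]. *)
rewrite (frobD 3) exprMn.
have -> : w ^+ (2 ^ 3) = w ^+ 2.
  by rewrite -[(2 ^ 3)%N]/(3 + 3 + 2)%N !exprD w3 !mul1r.
have -> : g ^+ 3 * ((y ^+ 8 + w ^+ 2 * s ^+ 8) * (y + w * s)) =
    g ^+ 3 * y ^+ 9 + w ^+ 3 * (g ^+ 3 * s ^+ 9)
    + (g ^+ 3 * (w * (y ^+ 8 * s)) + g ^+ 3 * (w ^+ 2 * (s ^+ 8 * y))) by ring.
rewrite w3 mul1r.
have -> : chi (g ^+ 3 * y ^+ 9 + g ^+ 3 * s ^+ 9
    + (g ^+ 3 * (w * (y ^+ 8 * s)) + g ^+ 3 * (w ^+ 2 * (s ^+ 8 * y)))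
    + b * (g * (w * y ^+ 2 * s + w ^+ 2 * y * s ^+ 2))) =
  chi (g ^+ 3 * y ^+ 9 + g ^+ 3 * s ^+ 9) * chi (g ^+ 3 * (w * (y ^+ 8 * s))) *
  chi (g ^+ 3 * (w ^+ 2 * (s ^+ 8 * y))) * chi (b * (g * (w * y ^+ 2 * s))) *
  chi (b * (g * (w ^+ 2 * y * s ^+ 2))).
  by rewrite -!chiD; congr chi; ring.
have -> : g ^+ 3 * s ^+ 9 = (g ^+ 3 * y ^+ 9) ^+ q.
  by rewrite !exprMn gq yq; ring.
rewrite chi_tr mul1r.
have -> : chi (g ^+ 3 * (w ^+ 2 * (s ^+ 8 * y))) =
          chi (g ^+ 3 * (w ^+ 2 * (y ^+ 8 * s))).
  by rewrite -[RHS]chi_conj !exprMn gq w_conj yq sq; congr chi; ring.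
have -> : chi (b * (g * (w ^+ 2 * y * s ^+ 2))) =
          chi (b ^+ q * (g * (w ^+ 2 * y ^+ 2 * s))).
  by rewrite -[RHS]chi_conj !exprMn conjK gq w_conj yq sq; congr chi; ring.
rewrite -!chiD; congr chi.
rewrite w2.
have -> : g ^+ 3 * (w * (y ^+ 8 * s)) + g ^+ 3 * ((w + 1) * (y ^+ 8 * s)) +
   b * (g * (w * y ^+ 2 * s)) + b ^+ q * (g * ((w + 1) * y ^+ 2 * s)) =
   g ^+ 3 * (y ^+ 8 * s) + g * (w * b + (w + 1) * b ^+ q) * (y ^+ 2 * s)
   + 2%:R * (g ^+ 3 * w * y ^+ 8 * s) by ring.
by rewrite two0 mul0r addr0.
Qed.

Lemma walshV_quadsum b :
  3 * walshV b = \sum_(i < 3) quadsum (g0 ^+ i) (w * b + w ^+ 2 * b ^+ q).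
Proof.
rewrite /walshV sum_noncube_cosets; apply: eq_bigr => i _.
by apply: quadsumE; rewrite exprAC g0_conj.
Qed.

Lemma quadsum_mod3 i b :
  exists s : int, quadsum (g0 ^+ i) (w * b + w ^+ 2 * b ^+ q) = 1 + 3 * s.
Proof.
rewrite -quadsumE; last by rewrite exprAC g0_conj.
pose G x := chi (x ^+ 3 + b * sigma q x).
exists (\sum_(x | x ^+ M == (g0 ^+ i) ^+ M) G x).
rewrite [LHS](sum_cube_coset G) ?expf_neq0 //; congr (_ + _).
by rewrite /G sigma0 mulr0 expr0n add0r chi0.
Qed.

(** * The radical of the quadratic form *)

(** The polar form of [form g l] vanishes on [h] exactly when
    [radical_poly g a h = 0], where [a = (l ^ q) ^ 4]; see [form_polar]. *)
Definition radical_poly g a h : F :=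
  h + a * g * h ^+ 4 + a ^+ (2 * q) * g ^+ 5 * h ^+ 16 + g ^+ 21 * h ^+ 64.

(* This keeps [conjM] from rewriting the square [x ^+ 2] as the product that it
   unfolds to. *)
Local Opaque GRing.exp.

Lemma form_polar g l y h : g ^+ q = g ->
  chi (form g l (y + h)) =
  chi (form g l y) * chi (form g l h)
  * chi ((g ^+ 3 * radical_poly g ((l ^+ q) ^+ 4) h) ^+ q * y ^+ 8).
Proof.
move=> gq; rewrite /form /radical_poly.
have [k lk kl] : exists2 k, l ^+ q = k & k ^+ q = l.
  by exists (l ^+ q); rewrite ?conjK.
have [s ys sy] : exists2 s, y ^+ q = s & s ^+ q = y.
  by exists (y ^+ q); rewrite ?conjK.
have [t ht th] : exists2 t, h ^+ q = t & t ^+ q = h.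
  by exists (h ^+ q); rewrite ?conjK.
rewrite conjD ys ht lk (frobD 3) (frobD 1).
have -> : (k ^+ 4) ^+ (2 * q) = l ^+ 8.
  by rewrite mulnC exprM (exprAC k) kl -exprM.
have -> : (g ^+ 3 * (h + k ^+ 4 * g * h ^+ 4 + l ^+ 8 * g ^+ 5 * h ^+ 16 +
     g ^+ 21 * h ^+ 64)) ^+ q =
  g ^+ 3 * (t + l ^+ 4 * g * t ^+ 4 + k ^+ 8 * g ^+ 5 * t ^+ 16 +
     g ^+ 21 * t ^+ 64).
  by rewrite !(conjD, conjM, conjX) gq ht lk kl.
(* Conjugation and Frobenius, which preserve the trace, turn every mixed term
   into a constant times [y ^ 8]. *)
have E1 : chi (g ^+ 3 * (h ^+ 8 * s)) = chi (g ^+ 24 * t ^+ 64 * y ^+ 8).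
  rewrite -[LHS]chi_conj -[LHS](chi_frob 3) !(conjM, conjX) gq ht sy.
  by congr chi; ring.
have E2 : chi (g * l * (y ^+ 2 * t)) = chi (g ^+ 4 * l ^+ 4 * t ^+ 4 * y ^+ 8).
  by rewrite -[LHS](chi_frob 2); congr chi; ring.
have E3 : chi (g * l * (h ^+ 2 * s)) = chi (g ^+ 8 * k ^+ 8 * t ^+ 16 * y ^+ 8).
  rewrite -[LHS]chi_conj -[LHS](chi_frob 3) !(conjM, conjX) gq lk ht sy.
  by congr chi; ring.
have -> : g ^+ 3 * ((y ^+ (2 ^ 3) + h ^+ (2 ^ 3)) * (s + t)) +
    g * l * ((y ^+ (2 ^ 1) + h ^+ (2 ^ 1)) * (s + t)) =
  (g ^+ 3 * (y ^+ 8 * s) + g * l * (y ^+ 2 * s)) +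
  (g ^+ 3 * (h ^+ 8 * t) + g * l * (h ^+ 2 * t)) +
  (g ^+ 3 * (y ^+ 8 * t) + g ^+ 3 * (h ^+ 8 * s)
   + g * l * (y ^+ 2 * t) + g * l * (h ^+ 2 * s)) by ring.
rewrite chiD [chi (_ + _ + (_ + _))]chiD; congr (_ * _).
rewrite !chiD E1 E2 E3 -!chiD; congr chi; ring.
Qed.

Local Transparent GRing.exp.

(** The radical of [form g l], for [a = (l ^ q) ^ 4]. *)
Definition radical g a : {set F} := [set h | radical_poly g a h == 0].

(** The form is additive on its radical and invariant under multiplication by
    [w], so from [h + w * h = w ^ 2 * h] it vanishes there. *)
Lemma chi_form_radical g l h : g ^+ q = g ->
  h \in radical g ((l ^+ q) ^+ 4) -> chi (form g l h) = 1.
Proof.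
move=> gq; rewrite inE => /eqP rh.
have fw y : form g l (w * y) = form g l y.
  rewrite /form !exprMn w_conj.
  have -> : w ^+ 8 * y ^+ 8 * (w * y ^+ q) =
    w ^+ 3 ^+ 3 * (y ^+ 8 * y ^+ q) by ring.
  have -> : w ^+ 2 * y ^+ 2 * (w * y ^+ q) = w ^+ 3 * (y ^+ 2 * y ^+ q) by ring.
  by rewrite w3 expr1n !mul1r.
have := form_polar g l (w * h) h gq; rewrite rh mulr0 expr0n gtn_eqF;
  last by lia.
rewrite mul0r chi0 mulr1 fw.
have -> : w * h + h = w * (w * h) by rewrite mulrA -expr2 w2 mulrDl mul1r.
by rewrite !fw chi_sq.
Qed.

Lemma quadsum_sqr g l : g ^+ q = g -> g != 0 ->
  quadsum g l ^+ 2 = (q ^ 2 * #|radical g ((l ^+ q) ^+ 4)|)%:Z.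
Proof.
move=> gq g0n; rewrite expr2 {1}/quadsum mulr_suml.
under eq_bigr => y _ do rewrite /quadsum (reindex_inj (addrI y)) mulr_sumr /=.
rewrite exchange_big /=.
rewrite (eq_bigr (fun h =>
  if h \in radical g ((l ^+ q) ^+ 4) then (q ^ 2)%:Z else 0)).
  by rewrite -big_mkcond sumr_const -[RHS]natz natrM -!natz mulr_natr.
move=> h _.
under eq_bigr => y _ do rewrite form_polar // mulrA mulrA chi_sq mul1r.
rewrite -mulr_sumr.
have -> :
  \sum_y chi ((g ^+ 3 * radical_poly g ((l ^+ q) ^+ 4) h) ^+ q * y ^+ 8) =
  \sum_y chi ((g ^+ 3 * radical_poly g ((l ^+ q) ^+ 4) h) ^+ q * y).
  by rewrite [RHS](reindex_inj (frob_inj 3)).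
rewrite sum_chi expf_eq0 mulf_eq0 !expf_eq0 (negbTE g0n) /= inE.
have -> : (0 < q)%N by lia.
case: eqP => [r0|_]; last by rewrite mulr0.
by rewrite chi_form_radical ?mul1r // inE r0.
Qed.

Lemma card_radical_le g a : g != 0 -> (#|radical g a| <= 64)%N.
Proof.
move=> g0n; pose p : {poly F} :=
  'X + (a * g) *: 'X^4 + (a ^+ (2 * q) * g ^+ 5) *: 'X^16 + (g ^+ 21) *: 'X^64.
have sp : (size p <= 65)%N.
  have sX c n : (n <= 64)%N -> (size (c *: 'X^n : {poly F})%R <= 65)%N.
    by move=> n64; rewrite (leq_trans (size_scale_leq _ _)) // size_polyXn ltnS.
  have sD (r s : {poly F}) :
      (size r <= 65)%N -> (size s <= 65)%N -> (size (r + s)%R <= 65)%N.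
    by move=> r65 s65; rewrite (leq_trans (size_polyD _ _)) // geq_max r65.
  by apply: (sD _ _ (sD _ _ (sD _ _ _ _) _) _); rewrite ?sX // size_polyX.
have p0 : p != 0.
  apply/eqP => /(congr1 (fun r : {poly F} => r`_1)) /eqP.
  by rewrite /p !coefD !coefZ coefX !coefXn /= !mulr0 !addr0 coef0 oner_eq0.
rewrite -ltnS cardE; apply: leq_trans sp; apply: max_poly_roots => //.
  apply/allP => h; rewrite mem_enum inE /radical_poly => rh.
  by rewrite rootE /p !hornerD !hornerZ hornerX !hornerXn.
exact: enum_uniq.
Qed.

Lemma radicalD g a h h' : h \in radical g a -> h' \in radical g a ->
  h + h' \in radical g a.
Proof.
rewrite !inE /radical_poly => /eqP r /eqP r'.
rewrite (frobD 2) (frobD 4) (frobD 6); apply/eqP;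
  rewrite -[RHS](addr0 0) -{1}r -r'.
ring.
Qed.

(** The radical is a subgroup of the additive group of F. *)
Lemma card_radical_pow2 g a : exists n, #|radical g a| = (2 ^ n)%N.
Proof.
have gs : group_set (radical g a : {set F}).
  apply/group_setP; split=> [|h h']; last exact: radicalD.
  by rewrite inE /radical_poly !expr0n /= !mulr0 !addr0.
have := cardSg (subsetT (Group gs)); rewrite /= cardsT cF qE -expnM.
by case/(dvdn_pfactor _ _ (isT : prime 2)) => n _ ->; exists n.
Qed.

(** Since the sum is 1 modulo 3, its sign is determined by its square, and the
    size of the radical is an even power of 2. *)
Lemma quadsum_val i b (g := g0 ^+ i) (l := w * b + w ^+ 2 * b ^+ q) :
  exists2 j, (j <= 3)%N & quadsum g l = (-2) ^+ j * q%:Z /\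
     #|radical g ((l ^+ q) ^+ 4)| = (4 ^ j)%N.
Proof.
have gq : g ^+ q = g by rewrite exprAC g0_conj.
have gn : g != 0 by rewrite expf_neq0.
have := quadsum_sqr g l gq gn.
have := card_radical_le g ((l ^+ q) ^+ 4) gn.
have [n ->] := card_radical_pow2 g ((l ^+ q) ^+ 4).
have [s] := quadsum_mod3 i b; rewrite -/g -/l => ->.
have [m qm] := q_mod3; rewrite qm => n6 sq.
have {}n6 : (n <= 6)%N by rewrite -(@leq_exp2l 2).
have {}sq : (1 + 3 * s) * (1 + 3 * s) = ((3 * m + 1) * (3 * m + 1) * 2 ^ n)%:Z.
  by rewrite -expr2 sq.
have sqrt c : (1 + 3 * s) * (1 + 3 * s) = c * c ->
    1 + 3 * s = c \/ 1 + 3 * s = - c.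
  move=> cc; have : (1 + 3 * s - c) * (1 + 3 * s + c) = 0.
    by rewrite -subr_sqr !expr2 cc subrr.
  by move/eqP; rewrite mulf_eq0 subr_eq0 addr_eq0 => /orP[] /eqP; [left|right].
(* Odd exponents [n] are impossible modulo 3. *)
case: n n6 sq => [|[|[|[|[|[|[|//]]]]]]] _ sq.
- exists 0%N => //; split=> //; case: (sqrt (3 * m + 1)%:Z); lia.
- lia.
- exists 1%N => //; split=> //; case: (sqrt ((3 * m + 1) * 2)%:Z); lia.
- lia.
- exists 2%N => //; split=> //; case: (sqrt ((3 * m + 1) * 4)%:Z); lia.
- lia.
- exists 3%N => //; split=> //; case: (sqrt ((3 * m + 1) * 8)%:Z); lia.
Qed.

(** * The norm of the companion matrix *)

Section Companion.

Variable a : F.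

Local Notation fr k := (map_mx (frob F k ch2)).

(** The companion matrix of the semilinear recursion defining the radical:
    if [v] is the row vector [h, g * h ^ 4, g ^ 5 * h ^ 16] with [h] in the
    radical, then [v *m companion] is [g] times the entrywise fourth power of
    [v]. *)
Definition companion : 'M[F]_3 := \matrix_(i, j)
  nth 0 (nth [::] [:: [:: 0; 0; 1]; [:: 1; 0; a]; [:: 0; 1; a ^+ (2 * q)]] i) j.

(** Gram matrix of a form, linear in the first argument and semilinear for
    [x |-> x ^ (2 * q)] in the second, that the recursion preserves. *)
Definition gram : 'M[F]_3 := \matrix_(i, j)
  nth 0 (nth [::] [:: [:: 0; 1; 0]; [:: 0; a; 1]; [:: 1; 0; 0]] i) j.

Let ord3 (P : 'I_3 -> Prop) :
  P ord0 -> P (lift ord0 ord0) -> P (lift ord0 (lift ord0 ord0)) ->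
  forall i, P i.
Proof.
move=> P0 P1 P2 [[|[|[|i]]] lti] //.
- by rewrite (_ : Ordinal lti = ord0) //; apply: val_inj.
- by rewrite (_ : Ordinal lti = lift ord0 ord0) //; apply: val_inj.
- by rewrite (_ : Ordinal lti = lift ord0 (lift ord0 ord0)) //; apply: val_inj.
Qed.

(** The matrix [fr e.+1 companion] is [companion] with entries raised to the
    power [2 * q = 2 ^ (e + 1)]. *)
Lemma companion_gram :
  companion *m fr 2 gram *m (fr e.+1 companion)^T = gram.
Proof.
have frq x : frob F e.+1 ch2 x = x ^+ (2 * q) by rewrite /frob expnS qE.
have aq : (a ^+ (2 * q)) ^+ (2 * q) = a ^+ 4.
  by rewrite !(mulnC 2) -exprM mulnACA exprM mulnn -cF expf_card.
have fr2 x : frob F 2 ch2 x = x ^+ 4 by [].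
apply/matrixP; apply: ord3; apply: ord3;
  rewrite !mxE !big_ord_recl !big_ord0 !mxE /= !big_ord_recl !big_ord0 !mxE /=;
  rewrite ?rmorph0 ?rmorph1 ?frq ?fr2 ?aq
    ?(mulr0, mul0r, mul1r, mulr1, addr0, add0r) //.
Qed.

Lemma det_companion : \det companion = 1.
Proof.
rewrite (expand_det_row _ ord0) !big_ord_recl big_ord0 !mxE /= !mul0r !add0r
  addr0 mul1r.
rewrite /cofactor (expand_det_row _ ord0) !big_ord_recl big_ord0 !mxE /= mul1r
  mul0r !addr0.
by rewrite /cofactor det_mx11 !mxE /=;
  rewrite !(expr1, expr0, mulr1, mul1r, expr2, mulrN1, opprK).
Qed.

Lemma det_gram : \det gram != 0.
Proof.
rewrite (expand_det_row _ ord0) !big_ord_recl big_ord0 !mxE /= !mul0r !add0r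
  addr0 mul1r.
rewrite /cofactor (expand_det_row _ ord0) !big_ord_recl big_ord0 !mxE /= mul1r
  mul0r !add0r addr0.
by rewrite /cofactor det_mx11 !mxE /= !mulr1 -exprD signr_eq0.
Qed.

(** The product of the first [n] twists of the companion matrix by powers of
    the map [x |-> x ^ 4]. *)
Fixpoint normC n : 'M[F]_3 :=
  if n is n'.+1 then normC n' *m fr (2 * n') companion else 1%:M.

Let fr_fr m n (k l : nat) (A : 'M[F]_(m, n)) : fr k (fr l A) = fr (k + l) A.
Proof. by apply/matrixP => i j; rewrite !mxE /frob -exprM -expnD addnC. Qed.

Let fr0 m n (A : 'M[F]_(m, n)) : fr 0 A = A.
Proof. by apply/matrixP => i j; rewrite !mxE /frob expr1. Qed.

Let fr_full m n (A : 'M[F]_(m, n)) : fr (2 * e) A = A.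
Proof.
apply/matrixP => i j; rewrite !mxE /frob.
by rewrite [(2 * e)%N]mulnC expnM -qE -cF expf_card.
Qed.

Lemma normCSr n : normC n.+1 = normC n *m fr (2 * n) companion.
Proof. by []. Qed.

Lemma normCS n : normC n.+1 = companion *m fr 2 (normC n).
Proof.
elim: n => [|n IH]; first by rewrite /= map_mx1 mul1mx mulmx1 fr0.
rewrite normCSr {1}IH normCSr map_mxM fr_fr mulmxA.
by rewrite (_ : 2 + 2 * n = 2 * n.+1)%N //; lia.
Qed.

Lemma det_normC n : \det (normC n) = 1.
Proof.
elim: n => [|n IH] /=; first exact: det1.
by rewrite det_mulmx IH mul1r det_map_mx det_companion rmorph1.
Qed.

Lemma normC_gram n :
  normC n *m fr (2 * n) gram *m (fr e.+1 (normC n))^T = gram.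
Proof.
elim: n => [|n IH]; first by rewrite /= map_mx1 trmx1 mulmx1 mul1mx fr0.
have stepE : fr (2 * n) companion *m fr (2 * n.+1) gram
    *m (fr e.+1 (fr (2 * n) companion))^T = fr (2 * n) gram.
  rewrite -[in RHS]companion_gram !map_mxM -map_trmx !fr_fr.
  rewrite (_ : 2 * n + 2 = 2 * n.+1)%N; last by lia.
  by rewrite [(e.+1 + _)%N]addnC.
by rewrite normCSr map_mxM trmx_mul -[RHS]IH -stepE !mulmxA.
Qed.

(* The norm of the companion matrix from F to the field of order 4. *)
Let B := normC e.

Lemma norm_gram : B *m gram *m (fr e.+1 B)^T = gram.
Proof. by have := normC_gram e; rewrite fr_full. Qed.

Let charB x := (char_poly B).[x].

Lemma char_normC_det x : charB x = \det (x%:M - B).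
Proof.
rewrite /charB -horner_evalE -det_map_mx; congr (\det _); apply/matrixP=> i j.
rewrite !mxE /= /horner_eval hornerD hornerN hornerC hornerMn hornerX.
by [].
Qed.

(** The values of the characteristic polynomial at the cube roots of unity lie
    in the prime field, because the norm preserves the form [gram]. *)
Lemma char_normC_prime x : x ^+ 3 = 1 -> x ^+ q = x ->
  (charB x == 0) || (charB x == 1).
Proof.
move=> x3 xq.
have tau : charB x ^+ (2 * q) = charB x.
  have -> : charB x ^+ (2 * q) = frob F e.+1 ch2 (charB x).
    by rewrite /frob expnS qE.
  rewrite char_normC_det -det_map_mx map_mxB map_scalar_mx /=.
  have -> : frob F e.+1 ch2 x = x ^+ 2.
    by rewrite /frob expnS -qE mulnC exprM xq.
  rewrite -[LHS]det_tr raddfB /= tr_scalar_mx.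
  apply: (mulfI det_gram); rewrite -[LHS]mul1r -{1}(det_normC e) -!det_mulmx.
  rewrite mulmxA mulmxBr norm_gram -/B.
  have -> : B *m gram *m (x ^+ 2)%:M - gram = (x ^+ 2 *: (B - x%:M)) *m gram.
    rewrite mul_mx_scalar scalerBr scale_scalar_mx -exprSr x3 mulmxBl mul1mx.
    by rewrite scalemxAl.
  rewrite !det_mulmx detZ -exprM mulnC exprM x3 expr1n mul1r mulrC;
    congr (_ * _).
  have -> : B - x%:M = (-1) *: (x%:M - B) by rewrite scaleN1r opprB.
  by rewrite detZ (oppr_pchar2 ch2) expr1n mul1r.
move: (charB x) tau => t tau.
(* The equation gives [t ^ 4 = t], hence [t ^ q = t], hence [t ^ 2 = t]. *)
have uu : (t ^+ q) ^+ 2 = t by rewrite -exprM mulnC.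
have t4 : t ^+ 4 = t.
  have tt : t ^+ 2 = t ^+ q by rewrite -[t in LHS]conjK exprAC uu.
  by rewrite (exprM t 2 2) tt.
have [//|t0] := eqVneq t 0; rewrite /=.
have t3 : t ^+ 3 = 1 by apply: (mulfI t0); rewrite -exprS t4 mulr1.
have tq : t ^+ q = t.
  by have [m ->] := q_mod3; rewrite exprD exprM t3 expr1n mul1r expr1.
by apply/eqP/(mulfI t0); rewrite mulr1 -{3}uu tq.
Qed.

(** The three values add up to [3 * (1 + \det B)], as 1, [w] and [w ^ 2], and
    likewise their squares, add up to 0. *)
Lemma char_normC_sum : charB 1 + charB w + charB (w ^+ 2) = 0.
Proof.
have [c1 [c2 DE]] : exists c1 c2, forall x,
    charB x = 1 + c1 * x + c2 * x ^+ 2 + x ^+ 3.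
  exists (char_poly B)`_1, (char_poly B)`_2 => x.
  rewrite /charB (@horner_coef_wide _ 4) ?size_char_poly // !big_ord_recl
    big_ord0 /= /bump /=.
  rewrite char_poly_det det_normC mulr1 (oppr_pchar2 ch2) expr1n !add1n mulr1
    expr1.
  have := char_poly_monic B;
    rewrite monicE lead_coefE size_char_poly => /eqP /= ->.
  by rewrite mul1r addr0 !addrA.
have w23 : w ^+ 2 ^+ 3 = 1 by rewrite exprAC w3 expr1n.
rewrite !DE !expr1n w23 w3.
have -> : 1 + c1 * 1 + c2 * 1 + 1 + (1 + c1 * w + c2 * w ^+ 2 + 1) +
     (1 + c1 * w ^+ 2 + c2 * w ^+ 2 ^+ 2 + 1) =
     c1 * (w ^+ 2 + w + 1) + c2 * (w ^+ 2 + w ^+ 3 * w + 1) + 2%:R * 3 by ring.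
by rewrite w3 mul1r g0_noncube two0 !(mulr0, mul0r) !addr0.
Qed.

Lemma eigenvalue_normC x : eigenvalue B x = (charB x == 0).
Proof. by rewrite eigenvalue_root_char. Qed.

(** Among the three cube roots of unity, either one or all three are
    eigenvalues of the norm. *)
Lemma norm_eigenvalues (E := fun i => eigenvalue B (w ^+ i)) :
  [|| [&& E 0, E 1 & E 2], [&& E 0, ~~ E 1 & ~~ E 2],
      [&& ~~ E 0, E 1 & ~~ E 2] | [&& ~~ E 0, ~~ E 1 & E 2]]%N.
Proof.
rewrite /E !eigenvalue_normC expr0 expr1; have := char_normC_sum.
have w23 : w ^+ 2 ^+ 3 = 1 by rewrite exprAC w3 expr1n.
have := @char_normC_prime 1 (expr1n _ _) (expr1n _ _);
  have := char_normC_prime _ w3 w_conj.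
have := @char_normC_prime (w ^+ 2) w23; rewrite exprAC w_conj => /(_ erefl).
by do 3!case/orP=> /eqP->; rewrite ?eqxx ?oner_eq0 ?addr0 ?add0r ?addff
  ?add0r ?eqxx => // /eqP; rewrite ?oner_eq0.
Qed.

Section Eigenvector.

Variables (g : F).
Hypotheses (gn : g != 0).

Let s n := (\sum_(k < n) 4 ^ k)%N.

Let expnm4 n : (s n * 3).+1 = (4 ^ n)%N.
Proof.
elim: n => [|n IH]; first by rewrite /s big_ord0.
by rewrite /s big_ord_recr /= -/(s n) expnS; lia.
Qed.

Let seM : s e = M.
Proof.
have q4 : (q ^ 2 = 4 ^ e)%N by rewrite qE -expnM mulnC expnM.
by have := expnm4 e; have := M3; rewrite q4; lia.
Qed.

(** The first three terms of the semilinear recursion attached to [h]. *)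
Definition radvec h : 'rV[F]_3 :=
  \row_j nth 0 [:: h; g * h ^+ 4; g ^+ 5 * h ^+ 16] j.

Lemma radvec_companion h : h \in radical g a ->
  radvec h *m companion = g *: fr 2 (radvec h).
Proof.
rewrite inE => /eqP rh.
apply/rowP; apply: ord3; rewrite !mxE !big_ord_recl big_ord0 !mxE /= /frob
  ?(mulr0, mul0r, mul1r, mulr1, addr0, add0r) //.
  by ring.
apply/eqP; rewrite -subr_eq0 -rh /radical_poly; apply/eqP.
rewrite (oppr_pchar2 ch2); ring.
Qed.

Lemma radvec_normC h n : h \in radical g a ->
  radvec h *m normC n = g ^+ s n *: fr (2 * n) (radvec h).
Proof.
move=> rh; elim: n => [|n IH]; first by rewrite /s big_ord0 scale1r mulmx1 fr0.
rewrite normCSr mulmxA IH -scalemxAl -map_mxM radvec_companion // map_mxZ fr_fr.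
rewrite scalerA /s big_ord_recr /= exprD (_ : 2 * n + 2 = 2 * n.+1)%N;
  last by lia.
have -> : frob F (2 * n) ch2 g = g ^+ (4 ^ n) by rewrite /frob expnM.
by [].
Qed.

Lemma radvec_eigen h : h \in radical g a -> radvec h *m B = g ^+ M *: radvec h.
Proof. by move=> rh; rewrite radvec_normC // fr_full seM. Qed.

Lemma radical_eigenvalue h : h \in radical g a -> h != 0 ->
  eigenvalue B (g ^+ M).
Proof.
move=> rh h0; apply/eigenvalueP; exists (radvec h); first exact: radvec_eigen.
by apply: contra_neq h0 => /rowP/(_ ord0); rewrite !mxE.
Qed.

(** Conversely, an eigenvector [v] has a multiple [c *: v] with a nonzero
    average under the semilinear map whose fixed points are the vectors
    [radvec h], for [h] in the radical (Hilbert's Theorem 90). *)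
Lemma eigenvalue_radical : eigenvalue B (g ^+ M) ->
  exists2 h, h \in radical g a & h != 0.
Proof.
case/eigenvalueP=> v vB v0.
have [k vk] : exists k, v 0 k != 0.
  apply/existsP; apply: contraNT v0 => /existsPn v0.
  by apply/eqP/rowP => k; rewrite mxE; have /negbNE/eqP := v0 k.
have uB n : normC n \in unitmx by rewrite unitmxE det_normC unitr1.
(* [T n c] is the [n]-th iterate of the semilinear map at [c *: v]; the map has
   order [e] there because [v] is an eigenvector. *)
pose T n c := g ^+ s n *: (fr (2 * n) (c *: v) *m invmx (normC n)).
have TS n c : T n.+1 c *m companion = g *: fr 2 (T n c).
  have -> : fr 2 (T n c) = g ^+ (4 * s n) *:
    (fr (2 * n.+1) (c *: v) *m fr 2 (invmx (normC n))).
    rewrite /T map_mxZ map_mxM fr_fr (_ : 2 + 2 * n = 2 * n.+1)%N; last by lia.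
    by congr (_ *: _); rewrite /= /frob -exprM mulnC.
  rewrite scalerA -exprS (_ : (4 * s n).+1 = s n.+1); last first.
    by have := expnm4 n; have := expnm4 n.+1; rewrite expnS; lia.
  rewrite /T -scalemxAl -mulmxA; congr (_ *: (_ *m _)).
  apply: (can_inj (mulKmx (uB n.+1)));
    rewrite mulKVmx // normCS -mulmxA -map_mxM.
  by rewrite mulmxV // map_mx1 mulmx1.
have T0 c : T 0 c = c *: v.
  by rewrite /T /s big_ord0 scale1r fr0 /= invmx1 mulmx1.
have Te c : T e c = c *: v.
  rewrite /T seM fr_full -scalemxAl scalerA mulrC -scalerA.
  by rewrite [g ^+ M *: _]scalemxAl -vB (mulmxK (uB e)).
pose u c := \sum_(n < e) T n c.
have uC c : u c *m companion = g *: fr 2 (u c).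
  have -> : u c *m companion = \sum_(n < e) T n.+1 c *m companion.
    rewrite /u mulmx_suml -(big_mkord predT (fun n => T n c *m companion)).
    rewrite -(big_mkord predT (fun n => T n.+1 c *m companion)).
    rewrite -(big_add1 _ _ 0 e.+1 predT (fun n => T n c *m companion)).
    rewrite big_ltn ?[in RHS]big_nat_recr /=; [|lia..].
    by rewrite Te -T0 addrC.
  rewrite /u raddf_sum scaler_sumr; apply: eq_bigr => n _; exact: TS.
have [c uc0] : exists c, u c 0 k != 0.
  have [|||c cE] := @linearized_nonzero 4 e.-1
     (fun n => g ^+ s n * (fr (2 * n) v *m invmx (normC n)) 0 k) => //.
  - by rewrite cF qE -expnM mulnC expnM ltn_exp2l //; lia.
  - by rewrite /s big_ord0 mul1r fr0 /= invmx1 mulmx1.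
  exists c; move: cE; rewrite prednK; last by lia.
  rewrite /u summxE; congr (_ != 0); apply: eq_bigr => n _.
  by rewrite /T map_mxZ -scalemxAl scalerA [RHS]mxE mulrAC /= {2}/frob expnM.
pose h := u c 0 ord0.
pose o1 : 'I_3 := lift ord0 ord0; pose o2 : 'I_3 := lift ord0 (lift ord0 ord0).
have col j : (u c *m companion) 0 j = g * u c 0 j ^+ 4 by rewrite uC !mxE.
have h1 : u c 0 o1 = g * h ^+ 4.
  rewrite -col !mxE !big_ord_recl big_ord0 !mxE /=.
  by rewrite ?(mulr0, mulr1, addr0, add0r).
have h2 : u c 0 o2 = g ^+ 5 * h ^+ 16.
  transitivity (g * u c 0 o1 ^+ 4); last by rewrite h1; ring.
  rewrite -col !mxE !big_ord_recl big_ord0 !mxE /=.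
  by rewrite ?(mulr0, mulr1, addr0, add0r).
exists h.
  rewrite inE /radical_poly; have := col o2; rewrite h2.
  rewrite !mxE !big_ord_recl big_ord0 !mxE /= -/o1 -/o2 h1 h2 mulr1 addr0 => E.
  apply/eqP; rewrite -[RHS](addff (g * (g ^+ 5 * h ^+ 16) ^+ 4)) -{1}E /h; ring.
apply: contra_neq uc0 => h0.
by apply: (ord3 (fun k => u c 0 k = 0)); rewrite ?h1 ?h2 ?h0 ?expr0n ?mulr0.
Qed.

End Eigenvector.

(** If all three cube roots of unity are eigenvalues, the eigenspaces are
    lines over F, and proportional vectors [radvec h] have a ratio in the field
    of order 4. *)
Lemma card_radical_le4 i : (i < 3)%N ->
    (forall j, (j < 3)%N -> eigenvalue B (w ^+ j)) ->
  (#|radical (g0 ^+ i) a| <= 4)%N.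
Proof.
move=> i3 eig; pose g := g0 ^+ i; have gn : g != 0 by rewrite expf_neq0.
have gM : g ^+ M = w ^+ i by rewrite exprAC wE.
have rk1 : (\rank (eigenspace B (w ^+ i)) <= 1)%N.
  have inj : {in predT &, injective (fun j : 'I_3 => w ^+ j)}.
    have d1 : w ^+ 2 != 1 by rewrite w2 -subr_eq0 addrK.
    have d2 : w ^+ 2 != w by rewrite w2 -subr_eq0 addrAC subrr add0r oner_eq0.
    move=> [[|[|[|j]]] lj] [[|[|[|k]]] lk] // _ _ /eqP /=;
      rewrite ?expr0 ?expr1 => H; apply: val_inj => //=; exfalso; move: H;
      by rewrite ?(eq_sym 1) ?(eq_sym w (w ^+ 2)) ?(negbTE d1) ?(negbTE d2)
                 ?(negbTE w_neq1).
  have := mxdirect_sum_eigenspace B inj; rewrite mxdirectE /= => /eqP rkE.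
  have := rank_leq_col (\sum_(j < 3) eigenspace B (w ^+ j))%MS.
  rewrite rkE (bigD1 (Ordinal i3)) //= => le3.
  have : (\sum_(j < 3 | j != Ordinal i3) 1 <= \sum_(j < 3 | j != Ordinal i3)
    \rank (eigenspace B (w ^+ j)))%N.
    by apply: leq_sum => j _; rewrite lt0n mxrank_eq0; apply: eig.
  rewrite sum1_card (_ : #|_| = 2) => [H|]; last by rewrite cardC1 card_ord.
  by rewrite -(leq_add2r 2); apply: leq_trans le3; rewrite leq_add2l.
case: (pickP [pred h | (h \in radical g a) && (h != 0)]) =>
  [h /andP[rh h0]|no]; last first.
  apply: (@leq_trans #|[set 0 : F]|); last by rewrite cards1.
  apply/subset_leq_card/subsetP => h rh; rewrite inE.
  by have := no h; rewrite /= rh => /negbFE.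
have vh0 : radvec g h != 0.
  by apply: contra_neq h0 => /rowP/(_ ord0); rewrite !mxE.
apply: (@leq_trans (size [:: 0; h; w * h; w ^+ 2 * h])) => //.
apply: leq_trans (card_size _); apply/subset_leq_card/subsetP => h' rh'.
have eigv x : x \in radical g a -> (radvec g x <= eigenspace B (w ^+ i))%MS.
  by move=> rx; apply/eigenspaceP; rewrite -gM radvec_eigen.
have : (radvec g h' <= radvec g h)%MS.
  apply: submx_trans (eigv _ rh') _.
  have := mxrank_leqif_sup (eigv _ rh) => -[_ <-].
  rewrite eqn_leq mxrankS ?eigv // (leq_trans rk1) // lt0n mxrank_eq0 //.
case/sub_rVP => c cE.
have h'E : h' = c * h by have /rowP/(_ ord0) := cE; rewrite !mxE.
have c4 : c ^+ 4 = c.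
  have /rowP/(_ (lift ord0 ord0)) := cE; rewrite !mxE /= h'E exprMn.
  by rewrite [g * _]mulrCA => /mulIf; apply; rewrite mulf_neq0 // expf_neq0.
have : c * (c - 1) * (c - w) * (c - w ^+ 2) = 0.
  have -> : c * (c - 1) * (c - w) * (c - w ^+ 2) =
    (c ^+ 4 - w ^+ 3 * c) + (w ^+ 2 + w + 1) * (c ^+ 2 * w - c ^+ 3) by ring.
  by rewrite g0_noncube w3 c4 mul1r mul0r addr0 subrr.
move/eqP; rewrite !mulf_eq0 !subr_eq0 h'E !inE => /orP[/orP[/orP[]|]|] /eqP->.
- by rewrite mul0r eqxx.
- by rewrite mul1r eqxx orbT.
- by rewrite eqxx !orbT.
- by rewrite eqxx !orbT.
Qed.

End Companion.

(** * The values of the Walsh transform *)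

Lemma eigenvalue_card_radical a i :
  eigenvalue (normC a e) (w ^+ i) = (1 < #|radical (g0 ^+ i) a|)%N.
Proof.
have gn : g0 ^+ i != 0 by rewrite expf_neq0.
have gM : (g0 ^+ i) ^+ M = w ^+ i by rewrite exprAC wE.
rewrite -gM; apply/idP/card_gt1P => [|[x [y [rx ry xy]]]].
  case/(eigenvalue_radical _ _ gn) => h rh h0; exists h, 0; split=> //.
  by rewrite inE /radical_poly !expr0n /= !mulr0 !addr0.
have rxy : x + y \in radical (g0 ^+ i) a by apply: radicalD.
apply: radical_eigenvalue rxy _ => //.
by rewrite addr_eq0 (oppr_pchar2 ch2).
Qed.

(** The exponents [j] of the three quadratic sums are either two zeros and one
    of 1, 2, 3, or three ones; the mean of the [(-2) ^ j] is then 0, 2 or -2. *)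
Lemma walshV_val_noncube b :
  [\/ walshV b = 0, walshV b = (2 * q)%:Z | walshV b = - (2 * q)%:Z].
Proof.
have := walshV_quadsum b; rewrite !big_ord_recl big_ord0 addr0 /= /bump /=
  !add1n.
set a := ((w * b + w ^+ 2 * b ^+ q) ^+ q) ^+ 4.
have eigE i j : #|radical (g0 ^+ i) a| = (4 ^ j)%N ->
    eigenvalue (normC a e) (w ^+ i) = (j != 0)%N.
  by move=> rE; rewrite eigenvalue_card_radical rE; case: j {rE} => // j;
    rewrite expnS; have := expn_gt0 4 j; lia.
have [j0 j03 [-> r0]] := quadsum_val 0 b.
have [j1 j13 [-> r1]] := quadsum_val 1 b.
have [j2 j23 [-> r2]] := quadsum_val 2 b.
have := norm_eigenvalues a; rewrite /= !(eigE _ _ r0, eigE _ _ r1, eigE _ _ r2).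
have all1 : j0 != 0%N -> j1 != 0%N -> j2 != 0%N ->
    [/\ j0 <= 1, j1 <= 1 & j2 <= 1]%N.
  move=> n0 n1 n2.
  have eig j : (j < 3)%N -> eigenvalue (normC a e) (w ^+ j).
    by case: j => [|[|[|j]]] // _;
      rewrite !(eigE _ _ r0, eigE _ _ r1, eigE _ _ r2).
  have le1 i j : (i < 3)%N -> #|radical (g0 ^+ i) a| = (4 ^ j)%N -> (j <= 1)%N.
    by move=> i3 rE; have := card_radical_le4 a i i3 eig;
      rewrite rE (@leq_exp2l 4 j 1).
  by split; [apply: le1 r0|apply: le1 r1|apply: le1 r2].
case: j0 j03 r0 all1 => [|[|[|[|//]]]] _ _;
  case: j1 j13 r1 => [|[|[|[|//]]]] _ _;
  case: j2 j23 r2 => [|[|[|[|//]]]] _ _ //= all1 _ V3;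
  try (by case: (all1 isT isT isT));
  rewrite ?expr0 ?expr1 ?exprS ?expr0 in V3;
  solve [constructor 1; lia | constructor 2; lia | constructor 3; lia].
Qed.

End Noncube.

Lemma walshV_val b :
  [\/ walshV b = 0, walshV b = (2 * q)%:Z | walshV b = - (2 * q)%:Z].
Proof.
have [g [gn gq gw]] := noncube_ex.
exact: (@walshV_val_noncube g _ gn gq erefl gw).
Qed.

(** * Moments *)

Section Moments.

(* The subfield of order [q]. *)
Variable Fq : {set F}.
Hypotheses (FqP : forall x, (x \in Fq) = (x ^+ q == x)) (cFq : #|Fq| = q).

Let FqD x y : x \in Fq -> y \in Fq -> x + y \in Fq.
Proof. by rewrite !FqP conjD => /eqP-> /eqP->. Qed.

Let FqM x y : x \in Fq -> y \in Fq -> x * y \in Fq.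
Proof. by rewrite !FqP conjM => /eqP-> /eqP->. Qed.

Let tr_Fq x : x + x ^+ q \in Fq.
Proof. by rewrite FqP conjD conjK addrC. Qed.

(** The absolute trace vanishes on the subfield, because every element of it
    has the form [y + y ^ q]. *)
Lemma chi_Fq u : u \in Fq -> chi u = 1.
Proof.
move=> uF.
have [t tF] : exists t, t \notin Fq.
  case: (pickP [pred t | t \notin Fq]) => [t tF|all]; first by exists t.
  have : (#|F| <= #|Fq|)%N.
    by apply/subset_leq_card/subsetP => x _; have /negbFE := all x.
  by rewrite cF cFq; nia.
have c0 : t + t ^+ q != 0.
  by apply: contra tF; rewrite FqP addr_eq0 (oppr_pchar2 ch2) eq_sym.
set c := t + _ in c0; have cq : c ^+ q = c by apply/eqP; rewrite -FqP tr_Fq.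
have -> : u = u * (t / c) + (u * (t / c)) ^+ q.
  move: uF; rewrite FqP => /eqP uq; rewrite !conjM uq exprVn cq -mulrDr -mulrDl.
  by rewrite divff // mulr1.
exact: chi_tr.
Qed.

Lemma sum_chi_Fq s : \sum_(b in Fq) chi (s * b) = if s \in Fq then q%:Z else 0.
Proof.
case: ifPn => sF.
  by under eq_bigr => b bF do rewrite chi_Fq ?FqM //;
    rewrite sumr_const cFq natz.
apply: (sum_chi_subgroup Fq s FqD).
have c0 : s + s ^+ q != 0.
  by apply: contra sF; rewrite FqP addr_eq0 (oppr_pchar2 ch2) eq_sym.
have [x0 x0E] := chi_nontriv.
exists (x0 / (s + s ^+ q) + (x0 / (s + s ^+ q)) ^+ q).
  exact: tr_Fq.
set y := x0 / _; rewrite mulrDr chiD.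
have -> : chi (s * y ^+ q) = chi (s ^+ q * y).
  by rewrite -[LHS]chi_conj conjM conjK.
by rewrite -chiD -mulrDl mulrC divfK.
Qed.

Lemma sum_walshV : \sum_b walshV b = (q ^ 2)%:Z.
Proof.
rewrite /walshV exchange_big /=.
rewrite (eq_bigr (fun x => if x == 0 then (q ^ 2)%:Z else 0)).
  by rewrite -big_mkcond big_pred1_eq.
move=> x _; under eq_bigr do rewrite chiD mulrC [_ * sigma q x]mulrC.
rewrite -mulr_suml sum_chi -{1}sigma0 (inj_eq (sigma_inj e_even qE cF)).
by case: eqP => [->|]; rewrite ?mul0r // expr0n chi0 mulr1.
Qed.

Lemma sum_walshV_sqr : \sum_b walshV b ^+ 2 = (q ^ 4)%:Z.
Proof.
transitivity (\sum_x \sum_y chi (x ^+ 3) * chi (y ^+ 3) *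
    \sum_b chi ((sigma q x + sigma q y) * b)).
  rewrite (eq_bigr (fun b => \sum_x \sum_y
     chi (x ^+ 3) * chi (y ^+ 3) * chi ((sigma q x + sigma q y) * b))) =>
       [|b _].
    rewrite exchange_big; apply: eq_bigr => x _; rewrite exchange_big.
    by apply: eq_bigr => y _; rewrite mulr_sumr.
  rewrite expr2 mulr_suml; apply: eq_bigr => x _; rewrite mulr_sumr.
  by apply: eq_bigr => y _; rewrite -!chiD; congr chi; ring.
rewrite (eq_bigr (fun=> (q ^ 2)%:Z)) => [|x _].
  by rewrite sumr_const cF -mulr_natr natz -PoszM -expnD.
rewrite (bigD1 x) //= [X in _ + X]big1 ?addr0 => [|y yx]; rewrite sum_chi.
  by rewrite addff eqxx chi_sq mul1r.
rewrite addr_eq0 (oppr_pchar2 ch2) (inj_eq (sigma_inj e_even qE cF)) eq_sym.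
by rewrite (negbTE yx) mulr0.
Qed.

(** On the subfield, [walshV] is the Walsh transform of the trace of
    [x ^ 3]. *)
Lemma walshV_Fq b : b \in Fq -> walshV b = \sum_x chi (x ^+ 3 + b * x).
Proof.
rewrite FqP => /eqP bq; apply: eq_bigr => x _.
rewrite /sigma; set d := (_ %/ 3)%N.
have -> : x ^+ 3 + b * (x + x ^+ d + x ^+ (d * q)) =
          x ^+ 3 + b * x + (b * x ^+ d + (b * x ^+ d) ^+ q).
  by rewrite conjM bq exprM; ring.
by rewrite chiD chi_tr mulr1.
Qed.

Lemma sum_walshV_Fq : \sum_(b in Fq) walshV b = (q ^ 2)%:Z.
Proof.
rewrite (eq_bigr _ walshV_Fq) exchange_big /=.
rewrite (eq_bigr (fun x => if x \in Fq then q%:Z else 0)) => [|x _].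
  by rewrite -big_mkcond sumr_const cFq -mulr_natr natz -PoszM mulnn.
under eq_bigr => b _ do rewrite chiD [b * x]mulrC.
rewrite -mulr_sumr sum_chi_Fq; case: ifP => xF; rewrite ?mulr0 //.
by rewrite chi_Fq ?mul1r // !exprS expr0 mulr1 !FqM.
Qed.

(** The field of order 4 is contained in the subfield, as [e] is even. *)
Lemma card_fixed4 : #|[set h in Fq | h ^+ 4 == h]| = 4.
Proof.
have [g [gn gq]] := noncube_ex; set w := g ^+ M => w0.
have wq : w ^+ q = w by rewrite /w exprAC gq.
have w2 : w ^+ 2 = w + 1.
  rewrite -[RHS]addr0 -w0.
  have -> : w + 1 + (w ^+ 2 + w + 1) = w ^+ 2 + (w + w + (1 + 1)) by ring.
  by rewrite !addff !addr0.
have w3 : w ^+ 3 = 1 by rewrite /w -exprM expM3.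
have wn0 : w != 0 by rewrite expf_neq0.
clearbody w.
have wn1 : w != 1.
  by apply: contra_eq_neq w2 => ->; rewrite expr1n addff oner_eq0.
have fE h : (h \in [set h in Fq | h ^+ 4 == h]) = (h \in [:: 0; 1; w; w ^+ 2]).
  rewrite !inE FqP; apply/andP/idP => [[_ /eqP h4]|].
    have : h * (h - 1) * (h - w) * (h - w ^+ 2) = 0.
      have -> : h * (h - 1) * (h - w) * (h - w ^+ 2) =
        (h ^+ 4 - w ^+ 3 * h) + (w ^+ 2 + w + 1) * (h ^+ 2 * w - h ^+ 3)
          by ring.
      by rewrite w0 w3 h4 mul1r mul0r addr0 subrr.
    by move/eqP; rewrite !mulf_eq0 !subr_eq0 -!orbA.
  case/or4P=> /eqP->; rewrite ?expr0n ?expr1n ?conjX ?wq; split;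
    rewrite ?eqxx //.
  - by rewrite gtn_eqF //; lia.
  - by rewrite exprS w3 mulr1.
  - by rewrite -exprM (exprD _ 6 2) (exprM _ 3 2) w3 expr1n mul1r.
rewrite (eq_card fE); apply/card_uniqP;
  rewrite /= !inE !negb_or !(eq_sym 0) (eq_sym 1 w) (eq_sym 1 (_ ^+ _)).
rewrite oner_eq0 wn0 wn1 expf_eq0 (negbTE wn0) w2 /= !andbT.
by rewrite -subr_eq0 addrK wn0 eq_sym -subr_eq0 addrAC subrr add0r oner_eq0.
Qed.

Lemma sum_walshV_sqr_Fq : \sum_(b in Fq) walshV b ^+ 2 = (4 * q ^ 3)%:Z.
Proof.
transitivity (\sum_h \sum_x chi (x ^+ 3) * chi ((x + h) ^+ 3) *
    \sum_(b in Fq) chi (h * b)).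
  rewrite (eq_bigr (fun b => \sum_h \sum_x
     chi (x ^+ 3) * chi ((x + h) ^+ 3) * chi (h * b))) => [|b bF].
    rewrite exchange_big; apply: eq_bigr => h _; rewrite exchange_big.
    by apply: eq_bigr => x _; rewrite mulr_sumr.
  rewrite walshV_Fq // expr2 mulr_suml exchange_big /=; apply: eq_bigr => x _.
  rewrite (reindex_inj (addrI x)) mulr_sumr /=; apply: eq_bigr => h _.
  rewrite -!chiD -[LHS]mulr1 -(chi_sq (b * x)) -!chiD.
  have -> : x ^+ 3 + b * x + ((x + h) ^+ 3 + b * (x + h)) + (b * x + b * x) =
    x ^+ 3 + (x + h) ^+ 3 + h * b + (b * x + b * x) + (b * x + b * x) by ring.
  by rewrite addff !addr0.
rewrite (eq_bigr (fun h =>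
  if h \in [set h in Fq | h ^+ 4 == h] then (q ^ 3)%:Z else 0)).
  by rewrite -big_mkcond sumr_const card_fixed4; lia.
move=> h _; rewrite sum_chi_Fq inE; case: ifP => hF; last first.
  by rewrite /=; apply: big1 => x _; rewrite mulr0.
rewrite -mulr_suml /=.
rewrite (eq_bigr (fun x => chi ((h + h ^+ 4) * x ^+ 2))) => [|x _].
  have -> : \sum_x chi ((h + h ^+ 4) * x ^+ 2) = \sum_x chi ((h + h ^+ 4) * x).
    by rewrite [RHS](reindex_inj (frob_inj 1)).
  rewrite sum_chi addrC addr_eq0 (oppr_pchar2 ch2).
  by case: eqP => _; rewrite ?mul0r // -PoszM -expnSr.
rewrite -chiD.
have -> : x ^+ 3 + (x + h) ^+ 3 =
   h * x ^+ 2 + h ^+ 2 * x + h ^+ 3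
   + 2%:R * (x ^+ 3 + x ^+ 2 * h + x * h ^+ 2) by ring.
rewrite two0 mul0r addr0 !chiD.
have -> : chi (h ^+ 3) = 1 by rewrite chi_Fq // !exprS expr0 mulr1 !FqM.
rewrite mulr1 -[X in _ * X](chi_frob 1) -chiD; congr chi; ring.
Qed.

(* The multiplicity of the value [v] outside the subfield. *)
Let N v := #|[set b in ~: Fq | walshV b == v]|.

Let N_sum v : (N v)%:Z = \sum_(b in ~: Fq) ((walshV b == v) : nat)%:Z.
Proof.
rewrite /N -sum1dep_card big_mkcondr (big_morph Posz PoszD erefl).
by apply: eq_bigr => b _; case: ifP.
Qed.

Lemma walshV_counts :
  [/\ (8 * N (2 * q)%:Z = q * (q - 4))%N, (8 * N (- (2 * q)%:Z) = q * (q - 4))%N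
    & (4 * N 0 = 3 * q ^ 2)%N].
Proof.
(* The moments of order 0, 1 and 2. *)
have total : (N 0)%:Z + (N (2 * q)%:Z)%:Z + (N (- (2 * q)%:Z))%:Z =
  (q ^ 2)%:Z - q%:Z.
  have -> : (q ^ 2)%:Z - q%:Z = \sum_(b in ~: Fq) 1.
    by rewrite sumr_const natz -cF -(cardsC Fq) cFq; lia.
  rewrite !N_sum -!big_split; apply: eq_bigr => b _ /=.
  by case: (walshV_val b) => ->; do ?case: eqP; lia.
have s1 : (2 * q)%:Z * ((N (2 * q)%:Z)%:Z - (N (- (2 * q)%:Z))%:Z) = 0.
  have : \sum_(b in ~: Fq) walshV b = 0.
    have := sum_walshV; rewrite (bigID (mem Fq)) /= sum_walshV_Fq => /eqP.
    rewrite -subr_eq0 addrAC subrr add0r => /eqP S0.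
    by rewrite -[RHS]S0; apply: eq_bigl => b; rewrite inE.
  move=> <-; rewrite !N_sum -sumrB mulr_sumr; apply: eq_bigr => b _.
  by case: (walshV_val b) => ->; do ?case: eqP; lia.
have s2 : (4 * q ^ 2)%:Z * ((N (2 * q)%:Z)%:Z + (N (- (2 * q)%:Z))%:Z) =
  (q ^ 4)%:Z - (4 * q ^ 3)%:Z.
  have : \sum_(b in ~: Fq) walshV b ^+ 2 = (q ^ 4)%:Z - (4 * q ^ 3)%:Z.
    have := sum_walshV_sqr; rewrite (bigID (mem Fq)) /= sum_walshV_sqr_Fq => <-.
    by rewrite addrAC subrr add0r; apply: eq_bigl => b; rewrite inE.
  move=> <-; rewrite !N_sum -big_split mulr_sumr; apply: eq_bigr => b _ /=.
  by case: (walshV_val b) => ->; do ?case: eqP; nia.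
have q0 : (0 < q)%N by lia.
have d : (N (2 * q)%:Z)%:Z = (N (- (2 * q)%:Z))%:Z.
  by apply/eqP; rewrite -subr_eq0; move/eqP: s1;
    rewrite mulf_eq0 => /orP[|//]; lia.
have s : 4 * ((N (2 * q)%:Z)%:Z + (N (- (2 * q)%:Z))%:Z) =
  (q ^ 2)%:Z - (4 * q)%:Z.
  have q2 : (q ^ 2)%:Z != 0 by rewrite eqz_nat expn_eq0; lia.
  have q4 : (q ^ 4)%:Z = (q ^ 2)%:Z * (q ^ 2)%:Z by rewrite -PoszM -expnD.
  have q3 : (4 * q ^ 3)%:Z = (q ^ 2)%:Z * (4 * q)%:Z.
    by rewrite -PoszM mulnCA -expnSr.
  have q24 : (4 * q ^ 2)%:Z = (q ^ 2)%:Z * 4 by rewrite -PoszM mulnC.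
  by apply: (mulfI q2); rewrite mulrA -q24 s2 q4 q3 -mulrBr.
have qq : (q * (q - 4) = q ^ 2 - 4 * q)%N
  by rewrite mulnBr mulnn [(q * 4)%N]mulnC.
have le4 : (4 * q <= q ^ 2)%N by rewrite -mulnn leq_mul2r q_ge4 orbT.
rewrite qq; move: (q ^ 2)%N le4 s total d => t.
move: (N _) (N _) (N _) => n0 n1 n2 le4 s total d; split; lia.
Qed.

End Moments.

(** * Walsh transforms and the subfield *)

(** The Walsh transform at [beta] for [alpha = c ^ 3] is that for [alpha = 1]
    at [beta / c], as [sigma q] commutes with scaling by [c]. *)
Lemma walsh_falpha c beta : c ^+ q = c -> c != 0 ->
  walsh (falpha e_even qE cF (c ^+ 3)) beta = walshV (beta / c).
Proof.
move=> cq c0; rewrite /walsh (reindex_inj (sigma_inj e_even qE cF)) /=.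
rewrite /walshV [RHS](reindex_inj (mulfI c0)) /=; apply: eq_bigr => x _.
rewrite /falpha /sigma_inv invF_f sigma_scale // exprMn mulrA divfK // chiD
  /chi.
by case: (absTrace _) => [[|[|]]] //= ?; case: (absTrace _) => [[|[|]]] //= ?.
Qed.

(** Fermat's little theorem in the subfield: multiplication by [x] permutes the
    nonzero elements, and [X ^ q - X] has at most [q] roots. *)
Lemma subfield_fixed (Fq : {set F}) : GRing.divring_closed Fq -> #|Fq| = q ->
  forall x, (x \in Fq) = (x ^+ q == x).
Proof.
move=> [F1 FB FV] cFq.
have F0 : 0 \in Fq by rewrite -(subrr 1) FB.
have FM x y : x \in Fq -> y \in Fq -> x * y \in Fq.
  move=> xF yF; have yV : y^-1 \in Fq by rewrite -[_^-1]mul1r FV.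
  by rewrite -[y]invrK FV.
have sub : {subset Fq <= [set x : F | x ^+ q == x]}.
  move=> x xF; rewrite inE; have [->|x0] := eqVneq x 0.
    by rewrite expr0n gtn_eqF //; lia.
  have prod0 : \prod_(y in Fq :\ 0) y != 0.
    by apply/prodf_neq0 => y; rewrite !inE => /andP[].
  have card0 : #|Fq :\ 0| = q.-1 by rewrite (cardsD1 0) F0 in cFq; rewrite -cFq.
  have : \prod_(y in Fq :\ 0) y = x ^+ q.-1 * \prod_(y in Fq :\ 0) y.
    rewrite {1}(reindex_inj (mulfI x0)) /= -card0 -prodr_const -big_split /=.
    apply: eq_bigl => y; rewrite !inE mulf_eq0 (negbTE x0) /=; congr (_ && _).
    apply/idP/idP => [xy|]; last exact: FM.
    by rewrite -[y](mulKf x0) mulrC FV.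
  move=> E; apply/eqP; rewrite -[q]prednK; last by lia.
  by rewrite exprS; apply: (mulIf prod0); rewrite -mulrA -E.
have fixle : (#|[set x : F | x ^+ q == x]| <= q)%N.
  pose p : {poly F} := 'X^q - 'X.
  have sp : size p = q.+1.
    by rewrite size_polyDl ?size_polyXn // size_polyN size_polyX; lia.
  have p0 : p != 0 by rewrite -size_poly_eq0 sp.
  rewrite cardE -ltnS -sp; apply: max_poly_roots p0 _ (enum_uniq _).
  by apply/allP => x; rewrite mem_enum inE rootE !hornerE subr_eq0.
have : Fq == [set x : F | x ^+ q == x].
  by rewrite eqEcard cFq fixle andbT; apply/subsetP.
by move=> /eqP -> x; rewrite inE.
Qed.

End QuadraticExtension.

Theorem theorem1p1 (q e : nat) (e_ge2 : (2 <= e)%N) (e_even : ~~ odd e)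
    (qE : q = (2 ^ e)%N) (F : finFieldType) (cF : #|F| = (q ^ 2)%N)
    (Fq : {set F}) (Fq_subfield : GRing.divring_closed Fq) (cFq : #|Fq| = q)
    (alpha : F) (alpha_cube : exists c : F, [/\ c \in Fq, c != 0 & alpha = c ^+ 3]) :
  let W := walsh (falpha e_even qE cF alpha) in
  [seq W beta | beta in ~: Fq] =i
    (if e == 2%N then [:: 0] else [:: - (2 * q)%:Z; 0; (2 * q)%:Z])
  /\ ((4 <= e)%N ->
      [/\ #|[set beta in ~: Fq | W beta == (2 * q)%:Z]| = (q * (q - 4) %/ 8)%N,
          #|[set beta in ~: Fq | W beta == - (2 * q)%:Z]| = (q * (q - 4) %/ 8)%N
        & #|[set beta in ~: Fq | W beta == 0]| = (3 * q ^ 2 %/ 4)%N]).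
Proof.
move=> W; case: alpha_cube => c [cF' c0 alphaE].
have FqP : forall x, (x \in Fq) = (x ^+ q == x).
  by apply: (@subfield_fixed F q e).
have cq : c ^+ q = c by apply/eqP; rewrite -FqP.
have WE beta : W beta = walshV F q (beta / c).
  by rewrite /W alphaE; apply: walsh_falpha.
have Wval beta : [\/ W beta = 0, W beta = (2 * q)%:Z | W beta = - (2 * q)%:Z].
  by rewrite WE; apply: (@walshV_val F q e).
pose N v := #|[set beta in ~: Fq | W beta == v]|.
have NE v : N v = #|[set b in ~: Fq | walshV F q b == v]|.
  have inj : injective (fun beta : F => beta / c).
    by apply: mulIf; rewrite invr_eq0.
  rewrite -(on_card_preimset (onW_bij _ (injF_bij inj)));
    apply: eq_card => beta.
  by rewrite !inE WE !FqP conjM exprVn cq (inj_eq inj).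
have [Np Nm N0] : [/\ (8 * N (2 * q)%:Z = q * (q - 4))%N,
    (8 * N (- (2 * q)%:Z) = q * (q - 4))%N & (4 * N 0 = 3 * q ^ 2)%N].
  by rewrite !NE; apply: (@walshV_counts F q e).
have q0 : (0 < q)%N by rewrite qE expn_gt0.
have inW v : (v \in [seq W beta | beta in ~: Fq]) = (0 < N v)%N.
  apply/imageP/card_gt0P => [[beta bF ->]|[beta]].
    by exists beta; rewrite inE bF eqxx.
  by rewrite inE => /andP[bF /eqP<-]; exists beta.
have valN v : (0 < N v)%N -> [\/ v = 0, v = (2 * q)%:Z | v = - (2 * q)%:Z].
  by case/card_gt0P => beta; rewrite inE => /andP[_ /eqP<-].
split=> [v|_]; last first.
  by split; rewrite -/(N _); [rewrite -Np | rewrite -Nm | rewrite -N0];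
    rewrite mulKn.
rewrite inW; case: eqP => [e2|e2].
  have q4 : q = 4%N by rewrite qE e2.
  have qq : (q * (q - 4) = 0)%N by rewrite q4.
  rewrite qq in Np Nm; rewrite !inE; apply/idP/eqP => [Nv|->].
    by case: (valN v Nv) => // vE; rewrite vE in Nv; lia.
  by move: (N _) N0 => n N0; rewrite q4 in N0; lia.
have q16 : (16 <= q)%N.
  have e4 : (4 <= e)%N.
    by have := e_even; have := e_ge2; case: (e) e2 => [|[|[|[|]]]].
  by rewrite qE -[16%N]/(2 ^ 4)%N leq_exp2l.
rewrite !inE; apply/idP/or3P => [/valN[]->|].
- by constructor 2.
- by constructor 3.
- by constructor 1.
have pos : (0 < q * (q - 4))%N by rewrite muln_gt0 q0; lia.
have pos2 : (0 < 3 * q ^ 2)%N by rewrite muln_gt0 expn_gt0 q0.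
case=> /eqP-> {v}; [move: Nm | move: N0 | move: Np].
- by move: (N _) => n; lia.
- by move: (N _) pos2 => n; move: (3 * q ^ 2)%N => t; lia.
- by move: (N _) => n; lia.
Qed.
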